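(* Let $\lambda=0$ and $\nu\in{}^\theta J^\bullet_+$. Then $${}^\theta\mathbf b^*_\nu={}^\theta\mathbf P^*_\nu+\sum_{\mu<\nu}({}^\theta\mathbf b^*_\nu,{}^\theta\mathbf P_\mu)\,{}^\theta\mathbf P^*_\mu .$$ Hence $\max({}^\theta\mathbf b^*_\nu)=\nu$ and the coefficient of the word $\nu$ in ${}^\theta\mathbf b_\nu^*$ is ${}^\theta\kappa_\nu$. In particular, if $\nu\in{}^\theta\mathcal L_+$ or $\nu$ is symmetric, then ${}^\theta\mathbf b^*_\nu={}^\theta\mathbf P^*_\nu$.
   Context: $J=\{\alpha_k: k\in\mathbb Z\text{ odd}\}$; on the free abelian group $\mathsf Q=\mathbb Z[J]$ the symmetric bilinear form is $\alpha_k\cdot\alpha_l=2$ if $k=l$, $-1$ if $|k-l|=2$, $0$ otherwise; $\theta$ is the involution $\alpha_k\mapsto\alpha_{-k}$, extended linearly, and ${}^\theta\beta=\beta+\theta(\beta)$. Words are finite sequences $\nu=\nu_1\cdots\nu_n$ in $J$, including the empty word $\varnothing$; $|\nu|=\sum_k\nu_k$, ${}^\theta|\nu|={}^\theta(|\nu|)$; ${}^\theta w(\nu)=\theta(\nu_n)\cdots\theta(\nu_1)$. $\mathcal K=\mathbb Q(q)$, $\mathcal A=\mathbb Z[q^{\pm1}]$, $[n]=(q^n-q^{-n})/(q-q^{-1})$, $[n]!=[n]\cdots[1]$, $[2n]!!=[2n][2n-2]\cdots[2]$; the bar involution on $\mathcal K$ is $q\mapsto q^{-1}$. $J$ is ordered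 by $\alpha_k\le\alpha_l\iff k\le l$, and words by the anti-lexicographic order (words are compared letter by letter from right to left; a proper right factor of a word is smaller than the word). For a linear combination $u$ of words, $\max(u)$ is the largest word occurring in it. $\mathbf f$ is the $\mathcal K$-algebra generated by $f_i$ ($i\in J$) with $q$-Serre relations: $f_if_j=f_jf_i$ if $i\cdot j=0$, and $f_i^2f_j-(q+q^{-1})f_if_jf_i+f_jf_i^2=0$ if $i\cdot j=-1$. It is graded with $f_i$ in degree $-i$; $-|u|$ is the degree of $u$. $\mathbf f_{\mathcal A}$ is the $\mathcal A$-subalgebra generated by all $f_i^{(k)}=f_i^k/[k]!$. $e_i^*\in\operatorname{End}_{\mathcal K}(\mathbf f)$: $e_i^*(1)=0$, $e_i^*(f_j)=\delta_{ij}$, $e_i^*(uv)=q^{-i\cdot|v|}e_i^*(u)v+ue_i^*(v)$. $\sigma:\mathbf f\to\mathbf f$ is the algebra anti-automorphism fixing all $f_i$. For homogeneous $u\in\mathbf f$, $\Psi(u)=\sum_{|\nu|=|u|}e^*_{\nu_1}\cdots e^*_{\nu_k}(u)\,\nu$. The Enomoto–Kashiwara algebra is the $\mathcal K$-algebra generated by $E_i,F_i,T_i^{\pm1}$ ($i\in J$) such that the $T_i$ commute, $T_{\theta(i)}=T_i$, $T_iE_jT_i^{-1}=q^{(i+\theta(i))\cdot j}E_j$, $T_iF_jT_i^{-1}=q^{-(i+\theta(i))\cdot j}F_j$, $E_iF_j=q^{-i\cdot j}F_jE_i+\delta_{ij}+\delta_{\theta(i)j}T_i$, and the $E_i$'s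 and the $F_i$'s satisfy the $q$-Serre relations. ${}^\theta V={}^\theta V(0)$ is its unique irreducible module generated by $v_0\ne0$ with $E_iv_0=0$, $T_iv_0=v_0$ for all $i$, and $\{u:E_iu=0\ \forall i\}=\mathcal Kv_0$. $\mathbf f$ acts via $f_i\mapsto F_i$ and ${}^\theta V=\mathbf f\cdot v_0$; the vector $F_\nu v_0$ has weight $-{}^\theta|\nu|$. There is a unique (non-degenerate) symmetric bilinear form on ${}^\theta V$ with $(v_0,v_0)=1$, $(E_iu,v)=(u,F_iv)$, and a unique bar involution with $\overline{v_0}=v_0$, $\overline{av}=\bar a\bar v$, $\overline{F_iv}=F_i\bar v$. ${}^\theta V^{\mathrm{low}}_{\mathcal A}=\mathbf f_{\mathcal A}v_0$ and ${}^\theta V^{\mathrm{up}}_{\mathcal A}=\{v: ({}^\theta V^{\mathrm{low}}_{\mathcal A},v)\subset\mathcal A\}$. For $u$ homogeneous of weight $-\beta$, ${}^\theta\Psi(u)=\sum_{{}^\theta|\nu|=\beta}{}^\theta\partial_\nu(u)\,\nu$ with ${}^\theta\partial_\nu(u)=E_{\nu_1}\cdots E_{\nu_k}(u)\in\mathcal Kv_0\cong\mathcal K$; this is an injective linear map to the span of words. Put ${}^\theta\mathbf V={}^\theta\Psi({}^\theta V)$, ${}^\theta\mathbf V_{\mathcal A}^{\mathrm{low}}={}^\theta\Psi({}^\theta V^{\mathrm{low}}_{\mathcal A})$, ${}^\theta\mathbf V_{\mathcal A}^{\mathrm{up}}={}^\theta\Psi({}^\theta V^{\mathrm{up}}_{\mathcal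 A})$, with the form and bar involution transported by ${}^\theta\Psi$. A word is good if it equals $\max(\Psi(x))$ for some nonzero homogeneous $x\in\mathbf f$, and $\theta$-good if it equals $\max({}^\theta\Psi(u))$ for some nonzero homogeneous $u\in{}^\theta V$; ${}^\theta J^\bullet_+$ is the set of $\theta$-good words ($\theta$-good words are good). A non-empty word is Lyndon if it is smaller than all its proper left factors; every word factors uniquely as $\nu=(\nu^{\langle l\rangle})^{n_l}\cdots(\nu^{\langle1\rangle})^{n_1}$ with Lyndon words (the Lyndon factors) $\nu^{\langle1\rangle}>\cdots>\nu^{\langle l\rangle}$ and $n_i\ge1$. The good Lyndon words are the words $\alpha_k\alpha_{k-2}\cdots\alpha_m$ with $m\le k$ odd. ${}^\theta\mathcal L_+$ is the set of good Lyndon words $\nu$ with $\nu\ge{}^\theta w(\nu)$. A word in ${}^\theta\mathcal L_+$ is symmetric if ${}^\theta w(\nu)=\nu$; a word in ${}^\theta J^\bullet_+$ is symmetric if all its Lyndon factors are symmetric. PBW vectors. For a good Lyndon word $\nu$, $P_\nu\in\mathbf f$ is the PBW root vector (obtained from Lusztig's braid group operators $T''_{i,1}$ for the convex order on positive roots induced by the order on good Lyndon words); explicitly, $P_{\alpha_m}=f_{\alpha_m}$ and $P_{\alpha_k\alpha_{k-2}\cdots\alpha_m}=P_{\alpha_{k-2}\cdots\alpha_m}f_{\alpha_k}-q^{-1}f_{\alpha_k}P_{\alpha_{k-2}\cdots\alpha_m}$ for $m<k$. Put $P_\nu^{[n]}=P_\nu^n/[n]!$ if $\nu$ is not symmetric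 and $P_\nu^{[n]}=P_\nu^n/[2n]!!$ if $\nu$ is symmetric. For $\nu=(\nu^{\langle l\rangle})^{n_l}\cdots(\nu^{\langle1\rangle})^{n_1}\in{}^\theta J_+^\bullet$, ${}^\theta P_\nu=\sigma\big(P^{[n_l]}_{\nu^{\langle l\rangle}}\cdots P^{[n_1]}_{\nu^{\langle1\rangle}}\big)\cdot v_0$, ${}^\theta\mathbf P_\nu={}^\theta\Psi({}^\theta P_\nu)$, and $${}^\theta\kappa_\nu=\prod_{i:\,\nu^{\langle i\rangle}\text{ symmetric}}[2n_i]!!\prod_{i:\,\nu^{\langle i\rangle}\text{ non-symmetric}}[n_i]! .$$ $\{{}^\theta\mathbf P_\nu\}$ is an $\mathcal A$-basis of ${}^\theta\mathbf V_{\mathcal A}^{\mathrm{low}}$ (PBW basis). The canonical basis $\{{}^\theta\mathbf b_\nu\mid\nu\in{}^\theta J^\bullet_+\}$ is the unique $\mathcal A$-basis of ${}^\theta\mathbf V_{\mathcal A}^{\mathrm{low}}$ with ${}^\theta\mathbf b_\nu={}^\theta\mathbf P_\nu+\sum_{\mu>\nu}c_{\nu\mu}{}^\theta\mathbf P_\mu$, $c_{\nu\mu}\in q\mathbb Z[q]$, $\overline{{}^\theta\mathbf b_\nu}={}^\theta\mathbf b_\nu$. $\{{}^\theta\mathbf P^*_\nu\}$ and $\{{}^\theta\mathbf b^*_\nu\}$ are the bases of ${}^\theta\mathbf V_{\mathcal A}^{\mathrm{up}}$ dual to $\{{}^\theta\mathbf P_\nu\}$ and $\{{}^\theta\mathbf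 b_\nu\}$ with respect to $(\cdot,\cdot)$. In the claim $\mu$ runs over $\theta$-good words with ${}^\theta|\mu|={}^\theta|\nu|$.
   Formalization: The root vectors are defined by P_{α_k w'} = f_{α_k}P_{w'} − q P_{w'}f_{α_k} (−q times the displayed recursion P_{w'}f_{α_k} − q^{-1}f_{α_k}P_{w'}); with the displayed one no canonical basis exists, already for the word α_1α_{-1}. *)

(* Defs.v *)
From HB Require Import structures.
From mathcomp Require Import all_boot all_order all_algebra generic_quotient.
From mathcomp Require Import ring_quotient finmap.
From mathcomp.multinomials Require Import monalg.
From mathcomp Require Import boolp classical_sets cardinality fsbigop.

Set Implicit Arguments.
Unset Strict Implicit.
Unset Printing Implicit Defensive.

Import Order.TTheory GRing.Theory.

Local Open Scope classical_set_scope.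
Local Open Scope ring_scope.
Local Open Scope quotient_scope.

Definition K : fieldType := {fraction {poly rat}}.

Definition q : K := tofrac ('X : {poly rat}).

(* [calA] is the subring of Laurent polynomials with integer coefficients. *)
Definition calA : set K :=
  [set x | exists (p : {poly int}) (n : nat),
      x = (map_poly (intr : int -> K) p).[q] / q ^+ n].

Definition qZq : set K :=
  [set x | exists p : {poly int}, x = q * (map_poly (intr : int -> K) p).[q]].

Definition at_qinv (p : {poly rat}) : K :=
  (map_poly (fun c : rat => tofrac c%:P : K) p).[q^-1].

(* Substitution of q^-1 for q; [repr x] is a fraction representing [x], and the
   value does not depend on it. *)
Definition barK (x : K) : K :=
  let r := repr (x : {fraction {poly rat}}) in at_qinv \n_r / at_qinv \d_r.

Definition qint (n : nat) : K := (q ^+ n - q ^- n) / (q - q^-1).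
Definition qfact (n : nat) : K := \prod_(1 <= k < n.+1) qint k.
(* [2n]!! *)
Definition qdfact (n : nat) : K := \prod_(1 <= k < n.+1) qint k.*2.

(* Quotient of an associative unital algebra by the two-sided ideal generated
   by a set R. The quotient may be the zero ring, so that it is a [pzRingType]
   and a [lmodType] rather than an [algType], which excludes the zero ring;
   [scale_pAl] and [scale_pAr] complete its algebra structure. *)

Section QuotAlg.
Variables (F : fieldType) (B : algType F) (R : set B).

Definition ideal : {pred B} := fun x =>
  `[< exists s : seq (B * B * B), (forall t, t \in s -> R t.1.2)
        /\ x = \sum_(t <- s) t.1.1 * t.1.2 * t.2 >].

Lemma ideal_zmod : zmod_closed ideal.
Proof.
split=> [|x y /asboolP[s [sR ->]] /asboolP[t [tR ->]]]; apply/asboolP.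
  by exists [::]; split=> //; rewrite big_nil.
exists (s ++ [seq (- u.1.1, u.1.2, u.2) | u <- t]); split=> [u|].
  by rewrite mem_cat => /orP[/sR//|/mapP[v /tR vR ->]].
rewrite big_cat big_map /= -sumrN; congr (_ + _).
by apply: eq_bigr => u _; rewrite !mulNr.
Qed.

HB.instance Definition _ := GRing.isZmodClosed.Build B ideal ideal_zmod.

Lemma idealMl a x : x \in ideal -> a * x \in ideal.
Proof.
move=> /asboolP[s [sR ->]]; apply/asboolP.
exists [seq (a * u.1.1, u.1.2, u.2) | u <- s]; split=> [u|].
  by case/mapP=> v /sR vR ->.
by rewrite big_map mulr_sumr; apply: eq_bigr => u _; rewrite !mulrA.
Qed.

Lemma idealMr a x : x \in ideal -> x * a \in ideal.
Proof.
move=> /asboolP[s [sR ->]]; apply/asboolP.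
exists [seq (u.1.1, u.1.2, u.2 * a) | u <- s]; split=> [u|].
  by case/mapP=> v /sR vR ->.
by rewrite big_map mulr_suml; apply: eq_bigr => u _; rewrite !mulrA.
Qed.

Definition quotAlg := Quotient.quot ideal.

HB.instance Definition _ := GRing.Zmodule.on quotAlg.

Definition qproj (x : B) : quotAlg := \pi x.
Definition qlift (x : quotAlg) : B := repr x.

Lemma qliftK x : qproj (qlift x) = x. Proof. exact: reprK. Qed.

Lemma qprojE x y : (qproj x == qproj y) = (x - y \in ideal).
Proof. by rewrite Quotient.idealrBE. Qed.

Lemma qproj_rel x : R x -> qproj x = qproj 0.
Proof.
move=> Rx; apply/eqP; rewrite qprojE subr0; apply/asboolP.
exists [:: (1, x, 1)]; split=> [t|]; first by rewrite inE => /eqP->.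
by rewrite big_seq1 /= mulr1 mul1r.
Qed.

Lemma qliftB x : qlift (qproj x) - x \in ideal.
Proof. by rewrite -qprojE qliftK. Qed.

Definition pone : quotAlg := qproj 1.
Definition pmul (x y : quotAlg) : quotAlg := qproj (qlift x * qlift y).
Definition pscale (c : F) (x : quotAlg) : quotAlg := qproj (c *: qlift x).

Lemma qproj_add x y : qproj x + qproj y = qproj (x + y).
Proof. exact/esym/(raddfD (\pi_(Quotient.quot ideal))). Qed.

Lemma qproj_mul x y : pmul (qproj x) (qproj y) = qproj (x * y).
Proof.
apply/eqP; rewrite qprojE.
rewrite -(subrK (qlift (qproj x) * y) (_ * _)) -mulrBr -addrA -mulrBl.
apply: rpredD; first exact/idealMl/qliftB.
exact/idealMr/qliftB.
Qed.

Lemma qproj_scale c x : pscale c (qproj x) = qproj (c *: x).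
Proof.
apply/eqP; rewrite qprojE -scalerBr -[X in c *: X]mul1r scalerAl.
exact/idealMl/qliftB.
Qed.

Lemma pmulA : associative pmul.
Proof.
move=> x y z; rewrite -[x]qliftK -[y]qliftK -[z]qliftK.
by rewrite !qproj_mul mulrA.
Qed.
Lemma pmul1l : left_id pone pmul.
Proof. by move=> x; rewrite -[x]qliftK qproj_mul mul1r. Qed.
Lemma pmul1r : right_id pone pmul.
Proof. by move=> x; rewrite -[x]qliftK qproj_mul mulr1. Qed.
Lemma pmulDl : left_distributive pmul +%R.
Proof.
move=> x y z; rewrite -[x]qliftK -[y]qliftK -[z]qliftK.
by rewrite !(qproj_add, qproj_mul) mulrDl.
Qed.
Lemma pmulDr : right_distributive pmul +%R.
Proof.
move=> x y z; rewrite -[x]qliftK -[y]qliftK -[z]qliftK.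
by rewrite !(qproj_add, qproj_mul) mulrDr.
Qed.

HB.instance Definition _ := GRing.Zmodule_isPzRing.Build quotAlg
  pmulA pmul1l pmul1r pmulDl pmulDr.

Lemma pscaleA a b v : pscale a (pscale b v) = pscale (a * b) v.
Proof. by rewrite -[v]qliftK !qproj_scale scalerA. Qed.
Lemma pscale1 : left_id 1 pscale.
Proof. by move=> v; rewrite -[v]qliftK qproj_scale scale1r. Qed.
Lemma pscaleDr : right_distributive pscale +%R.
Proof.
move=> a u v; rewrite -[u]qliftK -[v]qliftK.
by rewrite !(qproj_add, qproj_scale) scalerDr.
Qed.
Lemma pscaleDl v : {morph pscale^~ v : a b / a + b}.
Proof.
by move=> a b; rewrite -[v]qliftK !qproj_scale qproj_add scalerDl.
Qed.

HB.instance Definition _ := GRing.Zmodule_isLmodule.Build F quotAlg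
  pscaleA pscale1 pscaleDr pscaleDl.

Lemma scale_pAl c (x y : quotAlg) : c *: (x * y) = (c *: x) * y.
Proof.
rewrite -[x]qliftK -[y]qliftK.
transitivity (qproj (c *: (qlift x * qlift y))).
  by rewrite -qproj_scale -qproj_mul.
by rewrite scalerAl -qproj_mul -qproj_scale.
Qed.

Lemma scale_pAr c (x y : quotAlg) : c *: (x * y) = x * (c *: y).
Proof.
rewrite -[x]qliftK -[y]qliftK.
transitivity (qproj (c *: (qlift x * qlift y))).
  by rewrite -qproj_scale -qproj_mul.
by rewrite scalerAr -qproj_mul -qproj_scale.
Qed.

End QuotAlg.

Definition freeAlg (F : fieldType) (X : choiceType) := {malg F[{fmonom X}]}.

Section FreeAlg.
Variables (F : fieldType) (X : choiceType).

HB.instance Definition _ := GRing.Lalgebra.on (freeAlg F X).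

Lemma freeAlg_scalerAr c (x y : freeAlg F X) : c *: (x * y) = x * (c *: y).
Proof.
have mulC (g : {malg F[{fmonom X}]}) : g * c%:MP = c *: g.
  rewrite malgM_def fgmulgU malgZ_def.
  by apply: eq_bigr => k _; rewrite mulrC mulm1.
rewrite /freeAlg in x y *.
by rewrite scalerAl -mulC -mulrA mul_malgC.
Qed.

HB.instance Definition _ := GRing.Lalgebra_isAlgebra.Build F (freeAlg F X)
  freeAlg_scalerAr.

Definition gen (x : X) : freeAlg F X := << fmu x >>.

(* The value at [x] of the algebra morphism sending each generator [i] to
   [g i] *)
Definition evalAlg (B : algType F) (R : set B) (g : X -> quotAlg R)
    (x : freeAlg F X) : quotAlg R :=
  \sum_(m <- msupp x) x@_m *: \prod_(i <- (m : seq X)) g i.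

End FreeAlg.
Arguments gen {F X} x.

(* The odd integer k stands for the simple root alpha_k. *)
Definition J := {k : int | ~~ (2 %| k)%Z}.
HB.instance Definition _ := Choice.on J.

Lemma theta_subproof (i : J) : ~~ (2 %| - sval i)%Z.
Proof. by rewrite dvdzE abszN -dvdzE (svalP i). Qed.

Definition thetaJ (i : J) : J := exist _ (- sval i) (theta_subproof i).

Definition dotJ (i j : J) : int :=
  if sval i == sval j then 2
  else if `|sval i - sval j| == 2 then -1 else 0.

Definition rootQ := {malg int[J]}.
HB.instance Definition _ := GRing.Zmodule.on rootQ.

Definition alpha (i : J) : rootQ := << i >>.
Definition dotQ (x y : rootQ) : int :=
  \sum_(i <- msupp x) \sum_(j <- msupp y) x@_i * y@_j * dotJ i j.
Definition thetaQ (x : rootQ) : rootQ :=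
  \sum_(i <- msupp x) << x@_i *g thetaJ i >>.
Definition symQ (x : rootQ) : rootQ := x + thetaQ x.

Notation word := (seq J).

Definition wt (w : word) : rootQ := \sum_(i <- w) alpha i.
Definition twt (w : word) : rootQ := symQ (wt w).
Definition thetaw (w : word) : word := rev (map thetaJ w).

(* Anti-lexicographic order: lexicographic order of the reversed words *)
Definition wle (u v : word) : bool :=
  ((rev (map sval u) : seqlexi int) <= (rev (map sval v) : seqlexi int))%O.
Definition wlt (u v : word) : bool := (u != v) && wle u v.

Definition wordSpan := {malg K[word]}.
HB.instance Definition _ := GRing.Lmodule.on wordSpan.

Definition wordV (w : word) : wordSpan := << w >>.

Definition is_max (x : wordSpan) (w : word) : Prop :=
  x@_w != 0 /\ forall w', x@_w' != 0 -> wle w' w.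

(* Lyndon words and the Lyndon factorization. A factorization
   (nu^<l>)^(n_l) ... (nu^<1>)^(n_1) is the sequence of the pairs
   (nu^<i>, n_i), for i = l, ..., 1, so that the words increase. *)
Definition lyndon (w : word) : Prop :=
  w != [::] /\ forall u v, u != [::] -> v != [::] -> w = u ++ v -> wlt w u.

Definition is_lyndon_fact (w : word) (s : seq (word * nat)) : Prop :=
  [/\ forall p, p \in s -> lyndon p.1 /\ (0 < p.2)%N,
      sorted wlt (map fst s)
    & w = flatten [seq flatten (nseq p.2 p.1) | p <- s]].

Definition lyndon_fact (w : word) : seq (word * nat) :=
  xget [::] [set s | is_lyndon_fact w s].

(* A word is symmetric when its Lyndon factors are; [lsym] is symmetry of a
   Lyndon word. *)
Definition lsym (w : word) : bool := thetaw w == w.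
Definition wsym (w : word) : bool := all (fun p => lsym p.1) (lyndon_fact w).

Definition Kspan (M : lmodType K) (P : set word) (g : word -> M) : set M :=
  [set x | exists s : seq (K * word),
      (forall t, t \in s -> P t.2) /\ x = \sum_(t <- s) t.1 *: g t.2].

Definition is_Abasis (M : lmodType K) (L : set M) (G : set word)
    (b : word -> M) : Prop :=
  (forall w, G w -> L (b w)) /\
  (forall x, L x -> exists! c : wordSpan,
     ((forall w, w \in msupp c -> G w) /\ (forall w, calA c@_w))
     /\ x = \sum_(w <- msupp c) c@_w *: b w).

Inductive serre (B : algType K) (g : J -> B) : B -> Prop :=
| serre0 i j of dotJ i j = 0 : serre g (g i * g j - g j * g i)
| serre1 i j of dotJ i j = -1 :
    serre g (g i ^+ 2 * g j - (q + q^-1) *: (g i * g j * g i) + g j * g i ^+ 2).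

Definition fAlg := quotAlg (serre (@gen K J) : set (freeAlg K J)).
HB.instance Definition _ := GRing.PzRing.on fAlg.
HB.instance Definition _ := GRing.Lmodule.on fAlg.

Definition f_ (i : J) : fAlg := qproj _ (gen i).
Definition fword (w : word) : fAlg := \prod_(i <- w) f_ i.

(* The elements of degree -beta *)
Definition fhom (beta : rootQ) : set fAlg :=
  Kspan [set w | wt w = beta] fword.

Definition fdiv (i : J) (k : nat) : fAlg := (qfact k)^-1 *: f_ i ^+ k.

Inductive fA : fAlg -> Prop :=
| fA_div i k : fA (fdiv i k)
| fA_one : fA 1
| fA_sub x y of fA x & fA y : fA (x - y)
| fA_mul x y of fA x & fA y : fA (x * y)
| fA_scale a x of calA a & fA x : fA (a *: x).

(* The anti-automorphism fixing the generators, computed on a representative in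
   the free algebra *)
Definition sigma (x : fAlg) : fAlg :=
  \sum_(m <- msupp (qlift x : freeAlg K J))
     (qlift x : freeAlg K J)@_m *: fword (rev m).

(* These conditions determine the operators e_i^*. *)
Record is_estar (e : J -> fAlg -> fAlg) : Prop := IsEstar {
  estar_linear : forall i c u v, e i (c *: u + v) = c *: e i u + e i v;
  estar_one : forall i, e i 1 = 0;
  estar_gen : forall i j, e i (f_ j) = (i == j)%:R;
  estar_mul : forall i beta u v, fhom beta v ->
    e i (u * v) = q ^ (- dotQ (alpha i) beta) *: (e i u * v) + u * e i v
}.

Definition estar_word (e : J -> fAlg -> fAlg) (w : word) (u : fAlg) : K :=
  xget 0 [set c | foldr e u w = c *: (1 : fAlg)].

(* Psi in degree -beta *)
Definition Psi (e : J -> fAlg -> fAlg) (beta : rootQ) (u : fAlg) : wordSpan :=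
  \sum_(w \in [set w | wt w = beta]) estar_word e w u *: wordV w.

Definition good (e : J -> fAlg -> fAlg) (w : word) : Prop :=
  exists beta u, [/\ fhom beta u, u != 0 & is_max (Psi e beta u) w].

Definition theta_lyndon (e : J -> fAlg -> fAlg) (w : word) : Prop :=
  [/\ good e w, lyndon w & wle (thetaw w) w].

(* Root vectors; only the values at the good Lyndon words
   alpha_k alpha_(k-2) ... alpha_m are meaningful. For them the recursion
   follows from T''_{i,1}(f_j) = f_j f_i - q f_i f_j when i.j = -1. *)
Fixpoint rootP (w : word) : fAlg :=
  if w is i :: w' then
    if w' is [::] then f_ i
    else f_ i * rootP w' - q *: (rootP w' * f_ i)
  else 1.

Definition divP (w : word) (n : nat) : fAlg :=
  (if lsym w then qdfact n else qfact n)^-1 *: rootP w ^+ n.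

Definition kappa (w : word) : K :=
  \prod_(p <- lyndon_fact w) (if lsym p.1 then qdfact p.2 else qfact p.2).

Variant ekgen := gE of J | gF of J | gT of J | gTinv of J.

Definition ekgen_code (x : ekgen) : J + J + (J + J) :=
  match x with
  | gE i => inl (inl i) | gF i => inl (inr i)
  | gT i => inr (inl i) | gTinv i => inr (inr i)
  end.
Definition ekgen_decode (x : J + J + (J + J)) : ekgen :=
  match x with
  | inl (inl i) => gE i | inl (inr i) => gF i
  | inr (inl i) => gT i | inr (inr i) => gTinv i
  end.
Lemma ekgen_codeK : cancel ekgen_code ekgen_decode. Proof. by case. Qed.
HB.instance Definition _ := Choice.copy ekgen (can_type ekgen_codeK).

Section EKRelations.
Let E i : freeAlg K ekgen := gen (gE i).
Let F i : freeAlg K ekgen := gen (gF i).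
Let T i : freeAlg K ekgen := gen (gT i).
Let Tinv i : freeAlg K ekgen := gen (gTinv i).

Inductive ekrel : freeAlg K ekgen -> Prop :=
| ek_TTinv i : ekrel (T i * Tinv i - 1)
| ek_TinvT i : ekrel (Tinv i * T i - 1)
| ek_TT i j : ekrel (T i * T j - T j * T i)
| ek_thetaT i : ekrel (T (thetaJ i) - T i)
| ek_TE i j : ekrel (T i * E j * Tinv i
                     - q ^ dotQ (alpha i + alpha (thetaJ i)) (alpha j) *: E j)
| ek_TF i j : ekrel (T i * F j * Tinv i
                     - q ^ (- dotQ (alpha i + alpha (thetaJ i)) (alpha j)) *: F j)
| ek_EF i j : ekrel (E i * F j
                     - (q ^ (- dotJ i j) *: (F j * E i) + (i == j)%:R
                        + (if thetaJ i == j then T i else 0)))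
| ek_serreE x of serre E x : ekrel x
| ek_serreF x of serre F x : ekrel x.
End EKRelations.

Definition EK := quotAlg (ekrel : set (freeAlg K ekgen)).
HB.instance Definition _ := GRing.PzRing.on EK.
HB.instance Definition _ := GRing.Lmodule.on EK.

(* Left EK-modules, as K-vector spaces with an action of EK *)
Record ekModule := EKModule {
  ekspace :> lmodType K;
  ekact : EK -> ekspace -> ekspace;
  ekact1 : forall u, ekact 1 u = u;
  ekactM : forall a b u, ekact (a * b) u = ekact a (ekact b u);
  ekactDl : forall a b u, ekact (a + b) u = ekact a u + ekact b u;
  ekactDr : forall a u v, ekact a (u + v) = ekact a u + ekact a v;
  ekactZ : forall c a u, ekact (c *: a) u = c *: ekact a u
}.
Arguments ekact {e} _ _.

Section ThetaV.
Variable V : ekModule.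
Implicit Types (u v : V) (w : word).

Definition opE (i : J) : V -> V := ekact (qproj _ (gen (gE i)) : EK).
Definition opF (i : J) : V -> V := ekact (qproj _ (gen (gF i)) : EK).
Definition opT (i : J) : V -> V := ekact (qproj _ (gen (gT i)) : EK).

(* The action of f through the algebra morphism f -> EK, f_i |-> F_i *)
Definition f_act (x : fAlg) : V -> V :=
  ekact (evalAlg (fun i => qproj _ (gen (gF i)) : EK) (qlift x)).

Definition submodule (W : set V) : Prop :=
  [/\ W 0, forall u v, W u -> W v -> W (u + v)
    & forall a u, W u -> W (ekact a u)].

Variable v0 : V.

(* V is the module theta-V(0), generated by v0. *)
Record is_thetaV : Prop := IsThetaV {
  thetaV_v0 : v0 != 0;
  thetaV_E : forall i, opE i v0 = 0;
  thetaV_T : forall i, opT i v0 = v0;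
  thetaV_gen : forall u, exists a, u = ekact a v0;
  thetaV_irr : forall W, submodule W -> forall u, W u -> u != 0 ->
    forall v, W v;
  thetaV_ker : forall u, (forall i, opE i u = 0) <-> exists c, u = c *: v0
}.

(* The elements of weight -beta *)
Definition Vhom (beta : rootQ) : set V :=
  Kspan [set w | twt w = beta] (fun w => f_act (fword w) v0).

Record is_form (form : V -> V -> K) : Prop := IsForm {
  form_sym : forall u v, form u v = form v u;
  form_linear : forall c u u' v, form (c *: u + u') v = c * form u v + form u' v;
  form_v0 : form v0 v0 = 1;
  form_adj : forall i u v, form (opE i u) v = form u (opF i v)
}.

Record is_bar (bar : V -> V) : Prop := IsBar {
  bar_add : forall u v, bar (u + v) = bar u + bar v;
  bar_scale : forall a u, bar (a *: u) = barK a *: bar u;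
  bar_v0 : bar v0 = v0;
  bar_F : forall i u, bar (opF i u) = opF i (bar u);
  bar_invol : forall u, bar (bar u) = u
}.

Definition Vlow : set V := [set f_act x v0 | x in fA].
Definition Vup (form : V -> V -> K) : set V :=
  [set v | forall u, Vlow u -> calA (form u v)].

(* theta-Psi: first on the elements of weight -beta, then extended linearly to
   V along the weight decomposition. *)
Definition thetad (w : word) (u : V) : K :=
  xget 0 [set c | foldr opE u w = c *: v0].

Definition thetaPsi_hom (beta : rootQ) (u : V) : wordSpan :=
  \sum_(w \in [set w | twt w = beta]) thetad w u *: wordV w.

Definition weight_decomp (u : V) (d : rootQ -> V) : Prop :=
  [/\ forall beta, Vhom beta (d beta),
      finite_set [set beta | d beta != 0]
    & u = \sum_(beta \in [set: rootQ]) d beta].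

Definition thetaPsi (u : V) : wordSpan :=
  let d := xget (fun _ => 0) [set d | weight_decomp u d] in
  \sum_(beta \in [set: rootQ]) thetaPsi_hom beta (d beta).

Definition thetaPsi_inv (x : wordSpan) : V :=
  xget 0 [set u | thetaPsi u = x].

(* The structures transported to the image of theta-Psi *)
Definition bVlow : set wordSpan := thetaPsi @` Vlow.
Definition bVup (form : V -> V -> K) : set wordSpan := thetaPsi @` Vup form.
Definition bform (form : V -> V -> K) (x y : wordSpan) : K :=
  form (thetaPsi_inv x) (thetaPsi_inv y).
Definition bbar (bar : V -> V) (x : wordSpan) : wordSpan :=
  thetaPsi (bar (thetaPsi_inv x)).

Definition theta_good (w : word) : Prop :=
  exists beta u, [/\ Vhom beta u, u != 0 & is_max (thetaPsi u) w].

Definition thetaP (w : word) : V :=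
  f_act (sigma (\prod_(p <- lyndon_fact w) divP p.1 p.2)) v0.
Definition bP (w : word) : wordSpan := thetaPsi (thetaP w).

(* Sums over mu > nu or mu < nu are over theta-good words mu of the same weight
   as nu; there are finitely many. *)
Definition above (nu : word) : set word :=
  [set mu | [/\ theta_good mu, twt mu = twt nu & wlt nu mu]].
Definition below (nu : word) : set word :=
  [set mu | [/\ theta_good mu, twt mu = twt nu & wlt mu nu]].

Definition is_canonical_basis (bar : V -> V) (b : word -> wordSpan) : Prop :=
  is_Abasis bVlow theta_good b /\
  (forall nu, theta_good nu ->
     (exists c : word -> K, (forall mu, above nu mu -> qZq (c mu)) /\
        b nu = bP nu + \sum_(mu \in above nu) c mu *: bP mu)
     /\ bbar bar (b nu) = b nu).

Definition is_dual_basis (form : V -> V -> K) (b bs : word -> wordSpan) : Prop :=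
  is_Abasis (bVup form) theta_good bs /\
  (forall nu mu, theta_good nu -> theta_good mu ->
     bform form (bs nu) (b mu) = (nu == mu)%:R).

End ThetaV.

(* Main.v *)
(* Pairing a vector u with the vectors F_x v0 gives a functional on words; its
   values are the coefficients of Psi(u), so that a theta-good word is the largest
   word on which some functional of this kind does not vanish. Such a functional
   respects the Serre relations in every position, and its last letter can be
   flipped, because F_i v0 = F_theta(i) v0. Straightening by the Serre relations
   shows that a theta-good word, read from right to left, is a nonincreasing
   product of segments a, a+2, ..., b. Moreover a + b >= 0: otherwise the letters
   of the segment commute with the root vectors of all segments that follow, hence
   reach v0, where flipping kills the functional.

   The PBW vector of a theta-good word nu is kappa_nu^-1 F_nu v0 plus a combination
   of vectors of larger words. The triangular change of basis shows that b*_nu pairs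
   nontrivially with P_mu only for mu <= nu, and with P_nu to 1; comparing the two
   facts on the largest word of b*_nu shows that this word is nu, with coefficient
   kappa_nu. Finally, counting the letters k and -k shows that a theta-good word
   with one Lyndon factor, or with symmetric factors, is the smallest theta-good
   word of its weight, so that the sum over mu < nu is empty. *)

Require Import Defs.
From HB Require Import structures.
From mathcomp Require Import all_boot all_order all_algebra finmap.
From mathcomp Require Import zify ring.
From mathcomp.multinomials Require Import monalg.
From mathcomp Require Import boolp classical_sets cardinality fsbigop.

Set Implicit Arguments.
Unset Strict Implicit.
Unset Printing Implicit Defensive.

Import Order.TTheory GRing.Theory Num.Theory.

Local Open Scope classical_set_scope.
Local Open Scope ring_scope.

(** * Letters and the lexicographic order on reversed words *)

Definition num (i : J) : int := sval i.

Lemma num_inj : injective num. Proof. exact: val_inj. Qed.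

Lemma num_odd (i : J) : exists m : int, num i = 2 * m + 1.
Proof. by rewrite /num; case: i => k /= hk; exists (k %/ 2)%Z; lia. Qed.

(* Words are handled in reversed form, on which the anti-lexicographic order
   becomes the usual lexicographic order. *)
Fixpoint llt (x y : seq J) : bool :=
  match x, y with
  | _, [::] => false
  | [::], _ => true
  | a :: x', b :: y' => (num a < num b) || ((a == b) && llt x' y')
  end.

Lemma llt_trans : transitive llt.
Proof.
elim=> [|b y IH] [|a x] [|c z] //= /orP[ab|/andP[/eqP-> xy]] /orP[bc|/andP[/eqP<- yz]].
- by rewrite (lt_trans ab bc).
- by rewrite ab.
- by rewrite bc.
- by rewrite eqxx (IH _ _ xy yz) orbT.
Qed.

Lemma llt_irr x : llt x x = false.
Proof. by elim: x => //= a x ->; rewrite ltxx andbF. Qed.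

Lemma llt_cat2l p x y : llt (p ++ x) (p ++ y) = llt x y.
Proof. by elim: p => //= a p ->; rewrite ltxx eqxx. Qed.

Lemma llt_catr x y s t : size x = size y -> llt x y -> llt (x ++ s) (y ++ t).
Proof.
elim: x y => [|a x IH] [|b y] //= [sxy] /orP[->//|/andP[-> xy]].
by rewrite (IH _ sxy xy) orbT.
Qed.

Lemma llt_total x y : x != y -> llt x y || llt y x.
Proof.
elim: x y => [|a x IH] [|b y] //=; rewrite eqseq_cons negb_and.
have [->/= ne|ab _] := eqVneq a b; first by rewrite ltxx; apply: IH.
rewrite !orbF; case: (ltgtP (num a) (num b)) => // /num_inj E.
by rewrite E eqxx in ab.
Qed.

Lemma lexi_llt (x y : seq J) :
  ((map num x : seqlexi int) < (map num y : seqlexi int))%O = llt x y.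
Proof.
elim: x y => [|a x IH] [|b y] //=; rewrite ltxi_cons IH.
have [->|ab] := eqVneq a b; first by rewrite ltxx lexx.
by rewrite orbF; case: (ltgtP (num a) (num b)) => // /num_inj E; rewrite E eqxx in ab.
Qed.

Lemma map_num_inj : injective (map num).
Proof. exact/inj_map/num_inj. Qed.

Lemma wleE u v : wle u v = (u == v) || llt (rev u) (rev v).
Proof.
rewrite /wle le_eqVlt -!map_rev lexi_llt (inj_eq map_num_inj).
by rewrite (inj_eq (can_inj revK)).
Qed.

Lemma wltE u v : wlt u v = llt (rev u) (rev v).
Proof.
rewrite /wlt wleE; case: eqVneq => [->|] //=; by rewrite llt_irr.
Qed.

Lemma wle_refl u : wle u u. Proof. by rewrite wleE eqxx. Qed.

Lemma wle_trans : transitive wle.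
Proof.
move=> v u w; rewrite !wleE => /orP[/eqP->//|uv] /orP[/eqP<-|vw].
  by rewrite uv orbT.
by rewrite (llt_trans uv vw) orbT.
Qed.

Lemma wle_total u v : wle u v || wlt v u.
Proof.
rewrite wleE wltE; case: eqVneq => //= uv.
by apply: llt_total; rewrite (inj_eq (can_inj revK)).
Qed.

(** * Segments of consecutive odd integers *)

Lemma shift_subproof (a : J) (k : nat) : ~~ (2 %| num a + 2 * k%:Z)%Z.
Proof. by have [m ->] := num_odd a; lia. Qed.

Definition shift (a : J) (k : nat) : J := exist _ (num a + 2 * k%:Z) (shift_subproof a k).

Lemma num_shift a k : num (shift a k) = num a + 2 * k%:Z.
Proof. by []. Qed.

Definition seg (a : J) (n : nat) : seq J := [seq shift a k | k <- iota 0 n].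

Arguments num : simpl never.
Arguments shift : simpl never.

Lemma shift0 a : shift a 0 = a.
Proof. by apply: num_inj; rewrite ?num_shift; lia. Qed.

Lemma shift_shift a k l : shift (shift a k) l = shift a (k + l).
Proof. by apply: num_inj; rewrite ?num_shift; lia. Qed.

Lemma size_seg a n : size (seg a n) = n.
Proof. by rewrite size_map size_iota. Qed.

Lemma seg0 a : seg a 0 = [::]. Proof. by []. Qed.

Lemma seg_cons a n : seg a n.+1 = a :: seg (shift a 1) n.
Proof.
rewrite /seg /= shift0 (iotaDl 1 0 n) -map_comp; congr cons.
by apply: eq_map => k /=; rewrite shift_shift.
Qed.

Lemma seg_rcons a n : seg a n.+1 = rcons (seg a n) (shift a n).
Proof. by rewrite /seg -addn1 iotaD map_cat cats1. Qed.

Lemma seg_cat a m n : seg a (m + n) = seg a m ++ seg (shift a m) n.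
Proof.
rewrite /seg iotaD map_cat add0n -[m in iota m n]addn0 iotaDl -map_comp.
by congr cat; apply: eq_map => k /=; rewrite shift_shift.
Qed.

Lemma mem_seg j a n :
  (j \in seg a n) = (num a <= num j < num a + 2 * n%:Z).
Proof.
apply/mapP/idP => [[k]|].
  by rewrite mem_iota => hk ->; rewrite num_shift; lia.
have [m Hm] := num_odd j; have [l Hl] := num_odd a.
move=> h; exists `|m - l|%N; first by rewrite mem_iota; lia.
by apply: num_inj; rewrite ?num_shift; lia.
Qed.

Lemma seg_uniq a n : uniq (seg a n).
Proof.
rewrite map_inj_uniq ?iota_uniq // => k l /(congr1 num); rewrite ?num_shift; lia.
Qed.

Lemma count_seg j a n :
  count_mem j (seg a n) = (num a <= num j < num a + 2 * n%:Z) :> nat.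
Proof. by rewrite count_uniq_mem ?seg_uniq // mem_seg. Qed.

(** * The pairing of simple roots *)

Lemma dotJE i j :
  dotJ i j = if num i == num j then 2 else if `|num i - num j| == 2 then -1 else 0.
Proof. by []. Qed.

Lemma dotJC i j : dotJ i j = dotJ j i.
Proof. by rewrite !dotJE eq_sym distrC. Qed.

Lemma dotJ_far i j : num i + 2 < num j -> dotJ i j = 0.
Proof.
move=> h; rewrite dotJE; case: eqP => [?|_]; first lia.
by case: eqP => ?; lia.
Qed.

Lemma dotJ_shift a : dotJ a (shift a 1) = -1.
Proof.
rewrite dotJE num_shift; case: eqP => [?|_]; first lia.
by case: eqP => ?; lia.
Qed.

Variant dotJ_spec (i j : J) : Prop :=
| DotEq of i = j
| DotFar of dotJ i j = 0
| DotAbove of j = shift i 1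
| DotBelow of i = shift j 1.

Lemma dotJP i j : dotJ_spec i j.
Proof.
have [m Hm] := num_odd j; have [l Hl] := num_odd i.
case: (eqVneq (num i) (num j)) => [/num_inj->|ij]; first exact: DotEq.
case: (eqVneq (num j) (num i + 2)) => [h|h1].
  by apply: DotAbove; apply: num_inj; rewrite ?num_shift; lia.
case: (eqVneq (num i) (num j + 2)) => [h|h2].
  by apply: DotBelow; apply: num_inj; rewrite ?num_shift; lia.
apply: DotFar; rewrite dotJE; case: eqP => [?|_]; first lia.
by case: eqP => ?; lia.
Qed.

Lemma num_lt_step (i j : J) : num i < num j -> num i + 2 <= num j.
Proof.
by have [m ->] := num_odd j; have [l ->] := num_odd i; lia.
Qed.

Global Opaque seg.

(** Half of the statement that [x] is the largest word on which [phi] is nonzero. Only words of the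
    length of [x] are compared, since the Serre relations and the flip preserve the length. *)
Definition zero_above (F : fieldType) (phi : seq J -> F) (x : seq J) : Prop :=
  forall y, size y = size x -> llt x y -> phi y = 0.

(* The pair (a, n) stands for the n + 1 letters a, a+2, ..., a+2n. *)
Definition segw (s : J * nat) : seq J := seg s.1 s.2.+1.
Definition segsw (S : seq (J * nat)) : seq J := flatten (map segw S).
(** On the words [segw] this is the lexicographic order. *)
Definition seg_ge (s s' : J * nat) : bool :=
  (num s'.1 < num s.1) || (s'.1 == s.1) && (s'.2 <= s.2)%N.

Lemma span_prefix (T : Type) (P : pred T) (v : seq T) :
  exists p s, [/\ v = p ++ s, all P p & if s is c :: _ then ~~ P c else true].
Proof.
elim: v => [|c v [p [s [-> Pp Ps]]]]; first by exists [::], [::].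
case Pc: (P c); last by exists [::], (c :: p ++ s); rewrite /= Pc.
by exists (c :: p), s; rewrite /= Pc.
Qed.

(** If [r] ends before [p], then [a] meets a larger letter of [p]. If [p] ends first, a letter of
    [r], larger than [b], would meet the head of [s], which is at most [b], against the assumed
    inequality. *)
Lemma llt_insert (a b : J) (r t p s : seq J) :
  all (fun c => num b < num c) r -> all (fun c => num a < num c) p ->
  (if s is c :: _ then num c <= num b else true) ->
  llt (r ++ t) (p ++ s) -> llt (r ++ a :: t) (p ++ a :: s).
Proof.
elim: r p => [|c r IH] [|d p] /=.
- by move=> _ _ _ ->; rewrite eqxx orbT.
- by move=> _ /andP[-> _].
- move=> {IH}; case: s => // e s /andP[bc _] _ eb /orP[ce|/andP[/eqP ce _]].
    by lia.
  by rewrite ce in bc; lia.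
- move=> /andP[_ hr] /andP[_ hp] hs /orP[->//|/andP[-> h]].
  by rewrite IH ?orbT.
Qed.

(** * Functionals on words *)

Section SerreFunctionals.
Variables (F : fieldType) (q : F).
Implicit Types (phi : seq J -> F) (x y z p s : seq J) (S : seq (J * nat)).

(** The linear extension of [phi] to the free algebra vanishes on the two-sided ideal of the q-Serre
    relations. *)
Definition serre_fun phi : Prop :=
  (forall p i j s, dotJ i j = 0 ->
     phi (p ++ [:: i, j & s]) = phi (p ++ [:: j, i & s])) /\
  (forall p i j s, dotJ i j = -1 ->
     phi (p ++ [:: i, i, j & s]) - (q + q^-1) * phi (p ++ [:: i, j, i & s])
     + phi (p ++ [:: j, i, i & s]) = 0).

(** The last letter is the one that acts first on [v0], so this reflects
    $F_jv_0=F_{\theta(j)}v_0$. *)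
Definition flip_fun phi : Prop :=
  forall p j, phi (p ++ [:: j]) = phi (p ++ [:: thetaJ j]).

Lemma serre_fun_cat phi p : serre_fun phi -> serre_fun (fun y => phi (p ++ y)).
Proof.
case=> h1 h2; split=> [p1 i j s|p1 i j s] ij /=; rewrite !catA; [exact: h1|exact: h2].
Qed.

Lemma serre_fun_catr phi s : serre_fun phi -> serre_fun (fun y => phi (y ++ s)).
Proof. by case=> h1 h2; split=> * /=; rewrite -!catA; [apply: h1|apply: h2]. Qed.

Lemma flip_fun_cat phi p : flip_fun phi -> flip_fun (fun y => phi (p ++ y)).
Proof. by move=> h p1 j /=; rewrite !catA. Qed.

Lemma zero_above_cat phi p x :
  zero_above phi (p ++ x) -> zero_above (fun y => phi (p ++ y)) x.
Proof. by move=> h y sy xy; apply: h; rewrite ?size_cat ?sy ?llt_cat2l. Qed.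

Lemma comm_past phi c i p s : serre_fun phi -> all (fun j => dotJ i j == 0) p ->
  phi (c ++ i :: p ++ s) = phi (c ++ p ++ i :: s).
Proof.
move=> [h _]; elim: p c => //= j p IH c /andP[/eqP ij hp].
by rewrite h // -cat_rcons IH // cat_rcons.
Qed.

(** Swapping the two commuting letters gives a larger word. *)
Lemma far_descent_zero phi i j s : serre_fun phi -> num i + 2 < num j ->
  zero_above phi [:: i, j & s] -> phi [:: i, j & s] = 0.
Proof.
move=> [h _] ij za; rewrite (h [::]) ?dotJ_far // za //=.
by apply/orP; left; lia.
Qed.

Lemma seg_cons2 a n : seg a n.+2 = [:: a, shift a 1 & seg (shift a 2) n].
Proof. by rewrite !seg_cons shift_shift. Qed.

Lemma seg_far a b n : num a + 2 < num b ->
  all (fun j => dotJ a j == 0) (seg b n).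
Proof.
move=> ab; apply/allP => j; rewrite mem_seg => h.
by apply/eqP/dotJ_far; lia.
Qed.

Hypothesis t_neq0 : q + q^-1 != 0.

Lemma serre_solve (t u v w : F) : t != 0 -> u - t * v + w = 0 ->
  u = 0 -> w = 0 -> v = 0.
Proof.
move=> t0 + u0 w0; rewrite u0 w0 sub0r addr0 => /eqP.
by rewrite oppr_eq0 mulf_eq0 (negPf t0) => /eqP.
Qed.

(** Let b = a+2 and c = a+4. The repeated b commutes back to the place after c, and a b c b ... is
    the middle term of a Serre relation. Its outer terms a b b c ... and a c b b ... reduce to words
    beginning with b or c, which are larger. If the segment is only a b, the relation for b, b, a
    suffices. *)
Lemma seg_overlap_zero phi a n s : serre_fun phi ->
  zero_above phi (seg a n.+2 ++ shift a 1 :: s) ->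
  phi (seg a n.+2 ++ shift a 1 :: s) = 0.
Proof.
move=> sp za; have [h1 h2] := sp.
have big b y : num a < num b -> size y = (n.+2 + size s)%N -> phi (b :: y) = 0.
  move=> ab sy; apply: za; first by rewrite size_cat size_seg /= sy; lia.
  by rewrite seg_cons /= ab.
have n1 : num a < num (shift a 1) by rewrite num_shift; lia.
case: n => [|n] in za big *.
  have := h2 [::] (shift a 1) a s; rewrite dotJC dotJ_shift => /(_ erefl) /=.
  by rewrite !(big (shift a 1)) // mulr0 subrr add0r !seg_cons seg0.
rewrite seg_cons2 seg_cons shift_shift /=.
set b := shift a 1; set c := shift a 2; set r := seg _ n.
have -> : phi [:: a, b, c & r ++ b :: s] = phi [:: a, b, c, b & r ++ s].
  apply/esym/(comm_past [:: a; b; c] (i := b)) => //.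
  by apply: seg_far; rewrite !num_shift; lia.
have sr : size r = n by rewrite size_seg.
have bc : dotJ b c = -1 by rewrite -(dotJ_shift b) /b shift_shift.
have ba : dotJ b a = -1 by rewrite dotJC dotJ_shift.
have ac : dotJ a c = 0.
  by rewrite dotJE /c num_shift; case: eqP => [|?]; [lia|case: eqP => [|//]; lia].
apply: serre_solve (t_neq0) (h2 [:: a] b c (r ++ s) bc) _ _ => /=.
  have := h2 [::] b a (c :: r ++ s) ba; rewrite /= !(big b) ?mulr0 ?subrr ?add0r //=.
    by rewrite size_cat sr; lia.
  by rewrite size_cat sr; lia.
rewrite (h1 [::]) //= big //= ?num_shift ?size_cat ?sr; lia.
Qed.

(* Moving the second letter a next to the first one turns the word into
   a b a ..., which the Serre relation expresses through a a b ... and b a a ...;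
   the induction hypothesis for a + 2 applies to what follows a a. *)
Lemma seg_increase_zero phi a n s : serre_fun phi ->
  zero_above phi (seg a n.+1 ++ seg a n.+2 ++ s) ->
  phi (seg a n.+1 ++ seg a n.+2 ++ s) = 0.
Proof.
elim: n => [|n IH] in phi a * => sp za; have [h1 h2] := sp.
  rewrite !seg_cons !seg0 /= in za *.
  set b := shift a 1 in za *.
  have ab : num a < num b by rewrite num_shift; lia.
  have := h2 [::] a b s (dotJ_shift a); rewrite /=.
  rewrite (za [:: a, b, a & s]) //= ?ltxx ?eqxx ?ab //.
  by rewrite (za [:: b, a, a & s]) //= ?ab // mulr0 subr0 addr0.
set b := shift a 1; set r := seg (shift a 2) n.
set tl := seg b n.+2 ++ s.
have ab : num a < num b by rewrite num_shift; lia.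
have abd : dotJ a b = -1 by rewrite dotJ_shift.
have ex : seg a n.+2 ++ seg a n.+3 ++ s = [:: a, b & r ++ a :: tl].
  by rewrite seg_cons2 (seg_cons a n.+2).
rewrite ex in za *.
have big c y : num a < num c -> size y = size (b :: r ++ a :: tl) ->
    phi (c :: y) = 0.
  by move=> ac sy; apply: za; rewrite /= ?sy // ac.
have -> : phi [:: a, b & r ++ a :: tl] = phi [:: a, b, a & r ++ tl].
  apply/esym/(comm_past [:: a; b] (i := a)) => //.
  by apply: seg_far; rewrite !num_shift; lia.
apply: serre_solve (t_neq0) (h2 [::] a b (r ++ tl) abd) _ _ => /=; last first.
  by apply: big => //=; rewrite /tl !size_cat /= !size_cat; lia.
have er : b :: r ++ tl = seg b n.+1 ++ seg b n.+2 ++ s.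
  by rewrite (seg_cons b n) /b shift_shift.
rewrite er; apply: (IH (fun v => phi [:: a, a & v])).
  exact: (serre_fun_cat [:: a; a]).
(* If [v] begins with a letter above b, that letter commutes to the front. If it begins with b, the
   Serre relation reduces a a b ... to a b a .... *)
rewrite -er => -[|c v] //= [sv] /orP[bc|/andP[/eqP<- rv]].
  have ac : dotJ a c = 0.
    by apply: dotJ_far; have := num_lt_step bc; rewrite num_shift; lia.
  rewrite (h1 [:: a]) //= (h1 [::]) //= big //=; first lia.
  by rewrite sv /tl /= !size_cat /= !size_cat; lia.
have := h2 [::] a b v abd; rewrite /= (big b) //=; last first.
  by rewrite sv /tl /= !size_cat /= !size_cat; lia.
rewrite addr0 => /eqP; rewrite subr_eq0 => /eqP ->.
(* The second a moves behind the longest run of letters above b; the result is compared with the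
   original word, where the second a stands behind [r]. *)
have [p [w [ev hp hw]]] := span_prefix (fun c => num b < num c) v.
rewrite ev (_ : phi _ = 0) ?mulr0 //.
have -> : phi [:: a, b, a & p ++ w] = phi [:: a, b & p ++ a :: w].
  apply: (comm_past [:: a; b] (i := a)) => //.
  apply: sub_all hp => d bd; apply/eqP/dotJ_far.
  by have := num_lt_step bd; rewrite num_shift; lia.
apply: za; first by move: sv; rewrite ev /tl /= !(size_cat, size_seg) /= !(size_cat, size_seg); lia.
rewrite /= !ltxx !eqxx /=; apply: (@llt_insert a b).
- by apply/allP => d; rewrite mem_seg !num_shift; lia.
- by apply: sub_all hp => d; lia.
- by case: (w) hw => // d ?; rewrite -leNgt.
- by rewrite -ev.
Qed.

End SerreFunctionals.

(** * Segments and root vectors *)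

(** Each variable is the value at the word that it spells, x and z being commuting letters. The
    conclusion says that the middle letter y commutes with the root vector of x y z. *)
Lemma root_rank3_comm (F : fieldType) (q t xyzy yxzy zxyy zyxy yxyz yyxz yzyx xyyz zyyx : F) :
  q * t = q ^+ 2 + 1 -> t != 0 ->
  xyyz - t * xyzy + zxyy = 0 ->
  yyxz - t * yxyz + xyyz = 0 ->
  zyyx - t * zyxy + zxyy = 0 ->
  yyxz - t * yzyx + zyyx = 0 ->
  xyzy - q * yxzy - q * (zxyy - q * zyxy) = yxyz - q * yyxz - q * (yxzy - q * yzyx).
Proof.
move=> qt t0 e1 e2 e3 e4; apply: (mulfI t0); apply/eqP; rewrite -subr_eq0.
(* After multiplication by t, the difference of the two sides is this combination of the four Serre
   relations; the last summand vanishes because q t = q^2 + 1. *)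
apply/eqP; transitivity ((xyyz - t * xyzy + zxyy) * (- 1)
  + (yyxz - t * yxyz + xyyz) * 1
  + (zyyx - t * zyxy + zxyy) * (- q ^+ 2)
  + (yyxz - t * yzyx + zyyx) * (q ^+ 2)
  + (zxyy - yyxz) * (q ^+ 2 + 1 - q * t)); first by ring.
by rewrite e1 e2 e3 e4 qt subrr !(mul0r, mulr0) !addr0.
Qed.

Section Segments.
Variables (F : fieldType) (q : F).
Implicit Types (phi : seq J -> F) (x y z p s : seq J) (S : seq (J * nat)).

Lemma segsw_cons a n S : segsw ((a, n) :: S) = seg a n.+1 ++ segsw S.
Proof. by []. Qed.

(* [root_fun a n phi] is z |-> phi (R z) for the root vector R of the segment
   (a, n), phi being extended linearly to the free algebra. *)
Fixpoint root_fun (a : J) (n : nat) phi z : F :=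
  if n is n'.+1 then
    root_fun a n' phi (shift a n :: z)
    - q * root_fun a n' (fun y => phi (shift a n :: y)) z
  else phi (a :: z).

Lemma serre_root_fun a n phi : serre_fun q phi -> serre_fun q (root_fun a n phi).
Proof.
elim: n phi => [|n IH] phi sp; first exact: (serre_fun_cat [:: a] sp).
set b := shift a n.+1.
have [h1 h2] := IH _ sp; have [k1 k2] := IH _ (serre_fun_cat [:: b] sp).
split=> [p i j s ij|p i j s ij] /=; rewrite -/b.
  by rewrite -!cat_cons h1 // k1.
move: (h2 (b :: p) i j s ij) (k2 p i j s ij); rewrite !cat_cons /=.
set x1 := root_fun _ _ _ _; set x2 := root_fun _ _ _ _; set x3 := root_fun _ _ _ _.
set y1 := root_fun _ _ _ _; set y2 := root_fun _ _ _ _; set y3 := root_fun _ _ _ _.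
set t := q + q^-1; move=> e1 e2.
transitivity ((x1 - t * x2 + x3) - q * (y1 - t * y2 + y3)); first by ring.
by rewrite e1 e2 mulr0 subr0.
Qed.

Lemma flip_root_fun a n phi : flip_fun phi -> flip_fun (root_fun a n phi).
Proof.
elim: n phi => [|n IH] phi sp; first exact: (flip_fun_cat [:: a] sp).
move=> p j /=; rewrite -!cat_cons (IH _ sp); congr (_ - _ * _).
exact: (IH _ (flip_fun_cat [:: _] sp)).
Qed.

Lemma root_fun_ext a n phi psi z : phi =1 psi ->
  root_fun a n phi z = root_fun a n psi z.
Proof. by move=> /funext->. Qed.

(** The recursion can also strip the first letter: in a segment of at least three letters the first
    and the last one commute, so that the two nested brackets can be exchanged. *)
Lemma root_fun_left a n phi z : serre_fun q phi ->
  root_fun a n.+1 phi z =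
    root_fun (shift a 1) n (fun y => phi (a :: y)) z
    - q * root_fun (shift a 1) n phi (a :: z).
Proof.
elim: n phi z => [|n IH] phi z sp //.
set b := shift a n.+2.
have -> : root_fun a n.+2 phi z = root_fun a n.+1 phi (b :: z)
    - q * root_fun a n.+1 (fun y => phi (b :: y)) z by [].
rewrite IH // IH; last exact: (serre_fun_cat [:: b] sp).
have ab : dotJ a b = 0 by apply: dotJ_far; rewrite num_shift; lia.
rewrite /= shift_shift add1n -/b.
have -> : (fun y => phi [:: b, a & y]) = (fun y => phi [:: a, b & y]).
  by apply: funext => y; apply: (sp.1 [::]); rewrite dotJC.
rewrite ((serre_root_fun (shift a 1) n sp).1 [::] a b z ab) /=.
ring.
Qed.

(** The second summand of the recursion only contributes words beginning with a letter above [a],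
    hence larger than the segment; so the segment is the smallest word of its root vector, with
    coefficient 1. *)
Lemma root_fun_max a n phi z :
  (forall y, size y = n.+1 -> llt (seg a n.+1) y -> phi (y ++ z) = 0) ->
  root_fun a n phi z = phi (seg a n.+1 ++ z).
Proof.
have root0 m psi w : (forall y, size y = m.+1 -> psi (y ++ w) = 0) ->
    root_fun a m psi w = 0.
  elim: m psi w => [|m IH] psi w h /=; first exact: (h [:: a]).
  rewrite IH ?IH ?mulr0 ?subr0 // => y sy.
    by apply: (h (shift a m.+1 :: y)); rewrite /= sy.
  by rewrite -cat_rcons; apply: h; rewrite size_rcons sy.
elim: n z => [|n IH] z h; first by rewrite seg_cons.
have -> : root_fun a n.+1 phi z = root_fun a n phi (shift a n.+1 :: z)
    - q * root_fun a n (fun y => phi (shift a n.+1 :: y)) z by [].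
rewrite IH => [|y sy ly].
  rewrite root0 ?mulr0 ?subr0 => [|y sy].
    by rewrite (seg_rcons a n.+1) cat_rcons.
  apply: (h (shift a n.+1 :: y)); first by rewrite /= sy.
  by rewrite seg_cons /= num_shift; apply/orP; left; lia.
rewrite -cat_rcons; apply: h; first by rewrite size_rcons sy.
by rewrite seg_rcons -!cats1 llt_catr ?size_seg.
Qed.

(** The functional z |-> phi (R_1 ... R_k z), where R_i is the root vector of the i-th segment of
    [S]. *)
Fixpoint roots_fun S phi z : F :=
  if S is s :: S' then roots_fun S' (root_fun s.1 s.2 phi) z else phi z.

Lemma serre_roots_fun S phi : serre_fun q phi -> serre_fun q (roots_fun S phi).
Proof. by elim: S phi => // s S IH phi sp; apply/IH/serre_root_fun. Qed.

Lemma flip_roots_fun S phi : flip_fun phi -> flip_fun (roots_fun S phi).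
Proof. by elim: S phi => // s S IH phi sp; apply/IH/flip_root_fun. Qed.

Lemma roots_fun_max S phi : zero_above phi (segsw S) ->
  roots_fun S phi [::] = phi (segsw S).
Proof.
elim: S phi => //= -[a n] S IH phi za.
have max y : size y = size (segsw S) -> (y == segsw S) || llt (segsw S) y ->
    root_fun a n phi y = phi (seg a n.+1 ++ y).
  move=> sy _; apply: root_fun_max => w sw lw.
  apply: za; first by rewrite segsw_cons !size_cat sw sy size_seg.
  by rewrite segsw_cons llt_catr ?size_seg.
rewrite IH => [|y sy ly] /=; first by rewrite max ?eqxx.
rewrite max ?ly ?orbT //; apply: za; rewrite segsw_cons ?size_cat ?sy //.
by rewrite llt_cat2l.
Qed.

Hypothesis t_neq0 : q + q^-1 != 0.

(** Induction from the left: the first letter i starts a new segment or, if the next segment starts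
    at i+2, is glued to it. Every other configuration makes [phi x] vanish by the lemmas on far
    letters, overlaps and increases. *)
Lemma segs_of_max phi x : serre_fun q phi -> phi x != 0 -> zero_above phi x ->
  exists S, x = segsw S /\ sorted seg_ge S.
Proof.
elim: x phi => [|i x IH] phi sp nz za; first by exists [::].
have [S [ex sS]] := IH _ (serre_fun_cat [:: i] sp) nz (zero_above_cat (p := [:: i]) za).
have ex0 : i :: x = segsw ((i, 0%N) :: S).
  by rewrite segsw_cons seg_cons -ex.
case: S => [|[h n] S] in ex ex0 sS *; first by exists [:: (i, 0%N)].
rewrite segsw_cons in ex.
have [ih|hi|ih] := ltgtP (num i) (num h); last first.
- move/num_inj: ih => ih; subst h; case: n => [|n] in ex ex0 sS *.
    by exists [:: (i, 0%N), (i, 0%N) & S]; rewrite ex0 /= /seg_ge /= eqxx orbT.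
  case/eqP: nz; rewrite ex0 !segsw_cons -[n.+2]/(2 + n)%N seg_cat -catA in za *.
  exact: (seg_increase_zero t_neq0).
- by exists [:: (i, 0%N), (h, n) & S]; split=> //=; rewrite {1}/seg_ge /= hi.
have [eh|neh] := eqVneq h (shift i 1); last first.
  case/eqP: nz; rewrite ex seg_cons cat_cons in za *.
  apply: (far_descent_zero sp) => //; clear za.
  have := num_lt_step ih; rewrite le_eqVlt => /orP[/eqP e|//].
  by case/eqP: neh; apply: num_inj; rewrite num_shift -e; lia.
subst h; have ex' : i :: x = segsw ((i, n.+1) :: S).
  by rewrite ex segsw_cons (seg_cons i).
(* The next segment starts at i+2 or lower. Starting at i+2 it is an overlap, and starting at i with
   more letters than the glued segment it is an increase. *)
exists ((i, n.+1) :: S); split=> //.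
case: S => //= -[h m] S in ex ex' ex0 sS *; move: sS => /= /andP[+ ->].
rewrite !segsw_cons in ex'.
rewrite andbT /seg_ge /= => /orP[|/andP[/eqP eh mn]]; last first.
  case/eqP: nz; rewrite ex' (seg_cons h) eh cat_cons in za *.
  exact: (seg_overlap_zero t_neq0).
move/num_lt_step; rewrite num_shift.
have [//|hi hle|/num_inj eh _] := ltgtP (num h) (num i); first lia.
rewrite eh eqxx /=; rewrite leqNgt; apply/negP => nm.
have em : m.+1 = (n.+3 + (m - n.+2))%N by rewrite addSn subnKC.
case/eqP: nz; rewrite ex' eh em seg_cat -!catA in za *.
exact: (seg_increase_zero t_neq0).
Qed.

(* The condition on c c and c (c - 2) passes to c + 2 by the Serre relations,
   so that one can strip the letters of the segment one by one until only its
   last letter remains, whose flip is not the letter itself. *)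
Lemma flip_seg_zero c n phi : serre_fun q phi -> flip_fun phi ->
  (forall i t, i != c -> phi (i :: t) = 0) ->
  (forall t, phi [:: c, c & t] = 0) ->
  (forall d t, c = shift d 1 -> phi [:: c, d & t] = 0) ->
  phi (seg c n.+1) = 0.
Proof.
elim: n c phi => [|n IH] c phi sp fp hi hcc hcd; have [h1 h2] := sp.
  rewrite seg_cons (fp [::]) /= hi //; apply/eqP => /(congr1 num).
  have -> : num (thetaJ c) = - num c by [].
  by have [m ->] := num_odd c; lia.
have cc1 := dotJ_shift c; have c1c : dotJ (shift c 1) c = -1 by rewrite dotJC.
have c1 : shift c 1 != c.
  by apply/eqP => /(congr1 num); rewrite num_shift; lia.
rewrite seg_cons; apply: (IH _ (fun y => phi (c :: y))).
- exact: (serre_fun_cat [:: c]).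
- exact: (flip_fun_cat [:: c]).
- move=> i t ic1; case: (dotJP c i) => [<-|ci|e|e]; first exact: hcc.
  + have [->|ic] := eqVneq i c; first exact: hcc.
    by have /= -> := h1 [::] c i t ci; apply: hi.
  + by rewrite e eqxx in ic1.
  + exact: hcd.
- move=> t; have := h2 [::] (shift c 1) c t c1c.
  by rewrite /= !(hi (shift c 1)) // mulr0 subrr add0r.
- move=> d t e; have -> : d = c.
    by apply: num_inj; have := congr1 num e; rewrite !num_shift; lia.
  apply: serre_solve t_neq0 (h2 [::] c (shift c 1) t cc1) _ _ => /=.
    exact: hcc.
  exact: hi.
Qed.

Hypothesis q_neq0 : q != 0.

(** The induction strips an end letter that commutes with [j]: the last one if j = a+2 and there are
    at least four letters, the first one if j > a+2. What remains is the middle letter of three. *)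
Lemma root_fun_comm a n phi j z : serre_fun q phi ->
  num a < num j < num a + 2 * n%:Z ->
  root_fun a n phi (j :: z) = root_fun a n (fun y => phi (j :: y)) z.
Proof.
elim: n a phi z => [|n IH] a phi z sp /andP[aj jb]; first lia.
set b := shift a n.+1.
have := num_lt_step aj; rewrite le_eqVlt => /orP[/eqP ja|aj2].
  have {ja} ja : j = shift a 1 by apply: num_inj; rewrite num_shift -ja; lia.
  subst j; case: n => [|[|n]] in IH b jb *.
  - by rewrite num_shift in jb; lia.
  - set c := shift a 2 in b *; set e := shift a 1.
    have ec : dotJ e c = -1 by rewrite -(dotJ_shift e) /e shift_shift.
    have ea : dotJ e a = -1 by rewrite dotJC dotJ_shift.
    have ac : dotJ a c = 0.
      by rewrite dotJE /c num_shift; case: eqP => [|?]; [lia|case: eqP => [|//]; lia].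
    rewrite /= -/c -/e; have [h1 h2] := sp.
    have := h2 [:: a] e c z ec; have := h2 [::] e a (c :: z) ea.
    have := h2 [:: c] e a z ea; have := h2 [::] e c (a :: z) ec.
    have /= -> := h1 [:: e; e] a c z ac; have /= -> := h1 [::] a c [:: e, e & z] ac.
    have /= -> := h1 [:: e] a c (e :: z) ac.
    move=> /= e4 e3 e2 e1; apply: (root_rank3_comm _ _ t_neq0 e1 e2 e3 e4).
    by rewrite mulrDr mulfV.
  - set e := shift a 1; have be : dotJ b e = 0.
      by rewrite dotJC; apply: dotJ_far; rewrite !num_shift; lia.
    have -> psi y : root_fun a n.+3 psi y = root_fun a n.+2 psi (b :: y)
      - q * root_fun a n.+2 (fun y => psi (b :: y)) y by [].
    have -> : root_fun a n.+2 phi [:: b, e & z] = root_fun a n.+2 phi [:: e, b & z].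
      exact: ((serre_root_fun a n.+2 sp).1 [::] b e z be).
    rewrite IH //; last by rewrite !num_shift; lia.
    rewrite [X in _ - q * X]IH; [|exact: (serre_fun_cat [:: b] sp)|by rewrite !num_shift; lia].
    congr (_ - _ * _); apply: root_fun_ext => y.
    exact: (sp.1 [::] b e y be).
case: n => [|n] in IH b jb *; first lia.
have aj0 : dotJ a j = 0 by apply: dotJ_far; lia.
rewrite root_fun_left // [RHS]root_fun_left; last exact: (serre_fun_cat [:: j] sp).
rewrite IH; [|exact: (serre_fun_cat [:: a] sp)|by rewrite !num_shift; lia].
have -> : root_fun (shift a 1) n.+1 phi [:: a, j & z]
    = root_fun (shift a 1) n.+1 phi [:: j, a & z].
  exact: ((serre_root_fun (shift a 1) n.+1 sp).1 [::] a j z aj0).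
rewrite [X in _ - q * X]IH //; last by rewrite !num_shift; lia.
congr (_ - _ * _); apply: root_fun_ext => y.
exact: (sp.1 [::] a j y aj0).
Qed.

Lemma root_fun_comm_cat a n phi p z : serre_fun q phi ->
  all (fun j => num a < num j < num a + 2 * n%:Z) p ->
  root_fun a n phi (p ++ z) = root_fun a n (fun y => phi (p ++ y)) z.
Proof.
elim: p phi => [|j p IH] phi sp /=; first by [].
case/andP=> hj hp; rewrite root_fun_comm // IH //.
exact: (serre_fun_cat [:: j] sp).
Qed.

Lemma roots_fun_comm_cat S phi p z : serre_fun q phi ->
  all (fun s : J * nat => all (fun j => num s.1 < num j < num s.1 + 2 * s.2%:Z) p) S ->
  roots_fun S phi (p ++ z) = roots_fun S (fun y => phi (p ++ y)) z.
Proof.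
elim: S phi => [|[a n] S IH] phi sp //= /andP[hp hS].
rewrite IH //; last exact: serre_root_fun.
congr (roots_fun S _ z); apply: funext => y; exact: root_fun_comm_cat.
Qed.

End Segments.

(** * Weights and minimality *)

(* The coefficient of alpha_k in [twt w]. *)
Definition cnt (k : J) (w : seq J) : nat :=
  (count_mem k w + count_mem (thetaJ k) w)%N.

Lemma num_theta k : num (thetaJ k) = - num k.
Proof. by []. Qed.

Lemma cnt_cat k u v : cnt k (u ++ v) = (cnt k u + cnt k v)%N.
Proof. by rewrite /cnt !count_cat addnACA. Qed.

Lemma cnt_rev k u : cnt k (rev u) = cnt k u.
Proof. by rewrite /cnt !count_rev. Qed.

Lemma cnt_cons k i u : cnt k (i :: u) = (cnt k [:: i] + cnt k u)%N.
Proof. by rewrite -cat1s cnt_cat. Qed.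

Lemma cnt_seg k a n : cnt k (seg a n) =
  ((num a <= num k < num a + 2 * n%:Z)%R
   + (num a <= - num k < num a + 2 * n%:Z)%R)%N.
Proof. by rewrite /cnt !count_seg num_theta. Qed.

Lemma cnt_gt0 k u : k \in u -> (0 < cnt k u)%N.
Proof. by rewrite -has_pred1 has_count /cnt addn_gt0 => ->. Qed.

(** Absolute values merge k and -k, so equal counts make the two lists of absolute values
    permutations of each other. *)
Lemma size_cnt u v : (forall k, cnt k u = cnt k v) -> size u = size v.
Proof.
move=> uv; pose f (i : J) := `|num i|%N.
suff: perm_eq (map f u) (map f v) by move/perm_size; rewrite !size_map.
apply/allP => m; rewrite mem_cat => mf.
have [k ->] : exists k, m = f k by case/orP: mf => /mapP[k _ ->]; exists k.
have cf w : count_mem (f k) (map f w) = cnt k w.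
  rewrite count_map /cnt -count_predUI [X in (_ + X)%N](@eq_count _ _ pred0).
    rewrite count_pred0 addn0; apply: eq_count => i /=.
    apply/eqP/orP => [h|[/eqP->//|/eqP->]]; last by rewrite /f num_theta abszN.
    have [/num_inj->|e] : num i = num k \/ num i = - num k by rewrite /f in h; lia.
      by left.
    by right; apply/eqP/num_inj.
  move=> i /=; apply/negbTE/negP => /andP[/eqP-> /eqP /(congr1 num)].
  by rewrite num_theta; have [l ->] := num_odd k; lia.
by rewrite /= !cf uv.
Qed.

Lemma seg_ge_trans : transitive seg_ge.
Proof.
move=> [b m] [a n] [c l]; rewrite /seg_ge /=.
case/orP=> [ba|/andP[/eqP-> mn]]; case/orP=> [cb|/andP[/eqP-> lm]].
- by rewrite (lt_trans cb ba).
- by rewrite ba.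
- by rewrite cb.
- by rewrite eqxx (leq_trans lm mn) orbT.
Qed.

Lemma seg_ge_total s s' : seg_ge s s' || seg_ge s' s.
Proof.
case: s s' => [a n] [b m]; rewrite /seg_ge /=.
case: ltgtP => [_|_|/num_inj->] /=; rewrite ?orbT //.
by rewrite eqxx leq_total.
Qed.

Lemma seg_geE s s' : seg_ge s s' =
  (num s'.1 < num s.1) || ((num s'.1 == num s.1) && (s'.2 <= s.2)%N).
Proof. by rewrite /seg_ge (inj_eq num_inj). Qed.

Lemma segw_cat a n m : (m <= n)%N ->
  segw (a, n) = segw (a, m) ++ seg (shift a m.+1) (n - m).
Proof. by move=> mn; rewrite -[RHS]seg_cat addSn subnKC. Qed.

Lemma seg_ge_llt s s' : seg_ge s s' -> segw s' = segw s \/ llt (segw s') (segw s).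
Proof.
case: s s' => [a n] [b m]; rewrite /seg_ge /= => /orP[ba|/andP[/eqP-> mn]].
  by right; rewrite /segw /= !seg_cons /= ba.
rewrite (segw_cat a mn) -{1 3}[segw (a, m)]cats0 llt_cat2l.
case: (n - m)%N => [|k]; first by left.
by right; rewrite seg_cons.
Qed.

Lemma llt_seg_ge s s' : llt (segw s) (segw s') -> seg_ge s' s.
Proof.
have [//|] := orP (seg_ge_total s' s); case/seg_ge_llt => [->|h1 h2].
  by rewrite llt_irr.
by have := llt_trans h1 h2; rewrite llt_irr.
Qed.

Lemma segswS s S : segsw (s :: S) = segw s ++ segsw S.
Proof. by []. Qed.

Lemma segsw_cat S S' : segsw (S ++ S') = segsw S ++ segsw S'.
Proof. by rewrite /segsw map_cat flatten_cat. Qed.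

(** A larger first segment gives a larger word: if [s'] properly extends [s], its next letter
    exceeds the start of [s], which bounds the letter following [s] in the sorted product. *)
Lemma llt_segsw s S s' S' : sorted seg_ge (s :: S) -> s' != s ->
  llt (segsw (s' :: S')) (segsw (s :: S)) -> ~~ seg_ge s' s.
Proof.
case: s s' => [a n] [b m] sS ne lt; apply/negP => ge.
suff h : llt (segsw ((a, n) :: S)) (segsw ((b, m) :: S')).
  by have := llt_trans h lt; rewrite llt_irr.
move: ge ne; rewrite /seg_ge /= => /orP[ab|/andP[/eqP <- nm] ne].
  by rewrite !segsw_cons !seg_cons /= ab.
have {ne}nm : (n < m)%N.
  by rewrite ltn_neqAle nm andbT; apply: contra ne => /eqP->.
have -> : segsw ((a, m) :: S') = segw (a, n) ++ seg (shift a n.+1) (m - n) ++ segsw S'.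
  by rewrite catA -segw_cat 1?ltnW.
rewrite segsw_cons llt_cat2l.
have -> : (m - n)%N = (m - n).-1.+1 by rewrite prednK // subn_gt0.
rewrite seg_cons; case: S sS {lt} => //= -[c k] S /andP[ge _].
rewrite segsw_cons seg_cons /= num_shift; apply/orP; left.
by move: ge; rewrite seg_geE /=; lia.
Qed.

(** The number [num s.1 + s.2] is half the sum of the first and the last letter. *)
Definition seg_pos (s : J * nat) : bool := 0 <= num s.1 + s.2%:Z.
Definition seg_sym (s : J * nat) : bool := num s.1 + s.2%:Z == 0.

Lemma seg_symP s : reflect (num s.1 = - s.2%:Z) (seg_sym s).
Proof. by rewrite /seg_sym addr_eq0; apply: eqP. Qed.

Lemma cnt_segsw_eq k c S : (forall s, s \in S -> cnt k (segw s) = c) ->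
  cnt k (segsw S) = (c * size S)%N.
Proof.
elim: S => [|s S IH] h; first by rewrite muln0.
rewrite segswS cnt_cat h ?mem_head // IH ?mulnS //= => t tS.
by rewrite h // inE tS orbT.
Qed.

Lemma cnt_segsw_le k c S : (forall s, s \in S -> (cnt k (segw s) <= c)%N) ->
  (cnt k (segsw S) <= c * size S)%N.
Proof.
elim: S => [|s S IH] h //; rewrite segswS cnt_cat mulnS.
by rewrite leq_add ?h ?mem_head ?IH // => t tS; rewrite h // inE tS orbT.
Qed.

Lemma cnt_segsw_ge k s S : s \in S -> (cnt k (segw s) <= cnt k (segsw S))%N.
Proof.
elim: S => // t S IH; rewrite segswS cnt_cat inE.
by case/orP => [/eqP->|/IH]; lia.
Qed.

Lemma seg_ge_head (s t : J * nat) S : sorted seg_ge (s :: S) -> t \in s :: S ->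
  num t.1 <= num s.1.
Proof.
rewrite /= => /(order_path_min seg_ge_trans)/allP ge.
by rewrite inE => /orP[/eqP->//|/ge]; rewrite seg_geE; lia.
Qed.

(** At the first difference, let a be the start of the segment of [S]. By positivity the segments of
    [S'] from there on start below a and contain a, -a, a-2 and 2-a. Those of [S] all contain a and
    -a, but the first one misses a-2 and 2-a; so the counts of a and of a-2 cannot both agree. *)
Lemma symmetric_minimal S S' : all seg_sym S -> all seg_pos S' ->
  sorted seg_ge S -> sorted seg_ge S' ->
  (forall k, cnt k (segsw S) = cnt k (segsw S')) ->
  llt (segsw S') (segsw S) = false.
Proof.
elim: S S' => [|s S IH] S'; first by case: (segsw S').
move=> symS posS' sS sS' eqc; apply/negP => lt.
case: S' => [|s' S'] in posS' sS' eqc lt *.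
  have := size_cnt eqc; case: s {symS sS eqc lt} => a n.
  by rewrite segsw_cons size_cat size_seg.
have [es|ne] := eqVneq s' s.
  subst s'; move: lt; rewrite !segswS llt_cat2l.
  rewrite IH //; first by case/andP: symS.
  - by case/andP: posS'.
  - exact: path_sorted sS.
  - exact: path_sorted sS'.
  by move=> k; have := eqc k; rewrite !cnt_cat => /addnI.
have := llt_segsw sS ne lt; rewrite seg_geE => nge.
have symh : num s.1 = - s.2%:Z by case/andP: symS => /seg_symP.
have posh : 0 <= num s'.1 + s'.2%:Z by case/andP: posS'.
have lt1 : num s'.1 < num s.1 by lia.
have lt2 := num_lt_step lt1.
(* The letter a-2, written as a shift between two flips because [shift] only goes upwards. *)
pose d := thetaJ (shift (thetaJ s.1) 1).
have nd : num d = num s.1 - 2 by rewrite num_theta num_shift num_theta; lia.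
have [m odda] := num_odd s.1.
have c1 k : num k = num s.1 \/ num k = num s.1 - 2 ->
    cnt k (segsw (s' :: S')) = (2 * size (s' :: S'))%N.
  move=> hk; apply: cnt_segsw_eq => t tS'; rewrite /segw cnt_seg.
  have := seg_ge_head sS' tS'; have := allP posS' _ tS'; rewrite /seg_pos.
  by move=> ? ?; lia.
have c2 : cnt s.1 (segsw (s :: S)) = (2 * size (s :: S))%N.
  apply: cnt_segsw_eq => t tS; rewrite /segw cnt_seg.
  have := seg_ge_head sS tS; have /seg_symP := allP symS _ tS.
  by move=> ? ?; lia.
have c3 : (cnt d (segsw (s :: S)) <= 2 * size S)%N.
  rewrite segswS cnt_cat /segw cnt_seg nd.
  have -> : (num s.1 <= num s.1 - 2 < num s.1 + 2 * s.2.+1%:Z) = false by lia.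
  have -> : (num s.1 <= - (num s.1 - 2) < num s.1 + 2 * s.2.+1%:Z) = false by lia.
  by apply: cnt_segsw_le => t _; rewrite /segw cnt_seg; do 2!case: (_ <= _ < _).
move: (eqc d) (eqc s.1); rewrite (c1 d) ?c1 ?c2 /=; [lia|by left|by right].
Qed.

(** Counting b and -b for the start b of a segment of [S'] gives b >= a, so a smaller word must
    begin with a shorter segment at a. By length there is a further segment; it also starts at a,
    and then a and -a occur too often. *)
Lemma single_minimal s S' : seg_pos s -> all seg_pos S' -> sorted seg_ge S' ->
  (forall k, cnt k (segsw [:: s]) = cnt k (segsw S')) ->
  llt (segsw S') (segsw [:: s]) = false.
Proof.
case: s => a n posS posS' sS' eqc; apply/negP => lt.
case: S' => [|s' S'] in posS' sS' eqc lt *.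
  by have := size_cnt eqc; rewrite segsw_cons size_cat size_seg.
have [es|ne] := eqVneq s' (a, n).
  by subst s'; move: lt; rewrite !segsw_cons llt_cat2l; case: (segsw S').
have := llt_segsw (S := [::]) isT ne lt; rewrite seg_geE /= => nge.
have {}eqc k : cnt k (segsw (s' :: S')) = cnt k (seg a n.+1).
  by rewrite -eqc /segsw /= cats0.
have nlt (t : J * nat) : t \in s' :: S' -> num a <= num t.1.
  move=> tS'; rewrite leNgt; apply/negP => ta.
  have := cnt_segsw_ge t.1 tS'; rewrite eqc /segw !cnt_seg.
  by have := allP posS' _ tS'; move: posS; rewrite /seg_pos /=; lia.
have a1 := nlt _ (mem_head _ _).
have pos1 : 0 <= num s'.1 + s'.2%:Z by case/andP: posS'.
have odda := num_odd a.
case: S' => [|t T] in posS' sS' eqc nlt lt *.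
  by have := size_cnt eqc; rewrite /segsw /= cats0 !size_seg; lia.
have tS : t \in [:: s', t & T] by rewrite !inE eqxx orbT.
have a2 := nlt _ tS; have a3 := seg_ge_head sS' tS.
have pos2 : 0 <= num t.1 + t.2%:Z := allP posS' _ tS.
have := eqc a; rewrite !segswS !cnt_cat /segw !cnt_seg.
by case: odda => l; rewrite /seg_pos /= in posS *; lia.
Qed.

(** * Positivity of segments *)

Section Positivity.
Variables (F : fieldType) (q : F).
Hypotheses (q_neq0 : q != 0) (t_neq0 : q + q^-1 != 0).
Implicit Types (phi : seq J -> F) (x y z p s : seq J) (S : seq (J * nat)).

(** Homogeneity of root vectors; the prefix [u] records the letters absorbed into [phi] along the
    recursion. *)
Lemma root_fun_cnt a n phi u z (f : J -> nat) :
  (forall y, phi y != 0 -> forall k, cnt k (u ++ y) = f k) ->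
  root_fun q a n phi z != 0 -> forall k, cnt k (u ++ seg a n.+1 ++ z) = f k.
Proof.
elim: n phi u z => [|n IH] phi u z h nz k; first by rewrite seg_cons seg0; apply: h.
have [h0|h0] := eqVneq (root_fun q a n phi (shift a n.+1 :: z)) 0; last first.
  by rewrite seg_rcons cat_rcons; apply: IH h h0 k.
have h1 : root_fun q a n (fun y => phi (shift a n.+1 :: y)) z != 0.
  by apply: contra nz => /eqP e; rewrite /= h0 e mulr0 subr0.
rewrite seg_rcons cat_rcons -(IH _ (rcons u (shift a n.+1)) z _ h1 k) => [|y nzy j].
  by rewrite cat_rcons !cnt_cat (cnt_cons _ _ z) (cnt_cons _ _ (_ ++ z)) !cnt_cat; lia.
by rewrite cat_rcons; apply: h.
Qed.

Lemma roots_fun_cnt S phi u z (f : J -> nat) :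
  (forall y, phi y != 0 -> forall k, cnt k (u ++ y) = f k) ->
  roots_fun q S phi z != 0 -> forall k, cnt k (u ++ segsw S ++ z) = f k.
Proof.
elim: S phi u => [|[a n] S IH] phi u h nz k; first exact: h.
rewrite segsw_cons catA catA -(catA (_ ++ _)).
apply: IH nz k => y nzy j; rewrite -catA; exact: root_fun_cnt h nzy j.
Qed.

(* If the first segment is not positive, then it is contained in the interior of
   all others, so that its letters commute with their root vectors and reach the
   right end of the word. *)
Lemma segs_pos_of_max S phi : serre_fun q phi -> flip_fun phi ->
  sorted seg_ge S -> phi (segsw S) != 0 -> zero_above phi (segsw S) ->
  (forall y, phi y != 0 -> forall k, cnt k y = cnt k (segsw S)) ->
  all seg_pos S.
Proof.
elim: S phi => // -[a n] S IH phi sp fp sS nz za hom.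
have posS : all seg_pos S.
  apply: (IH (fun y => phi (seg a n.+1 ++ y))) => //.
  - exact: serre_fun_cat.
  - exact: flip_fun_cat.
  - exact: path_sorted sS.
  - exact: zero_above_cat.
  by move=> y nzy k; have := hom _ nzy k; rewrite segsw_cons !cnt_cat => /addnI.
rewrite /= posS andbT; apply/negP => /negP; rewrite /seg_pos -ltNge /= => neg.
(* With the root vectors of the other segments placed before it, the argument of [psi] stands at the
   right end, where the flip acts. By weight, [psi] only sees words with the counts of the first
   segment. *)
pose psi := roots_fun q S phi.
have inner p : all (fun j => num a <= num j <= - num a) p ->
    psi p = roots_fun q S (fun y => phi (p ++ y)) [::].
  move=> hp; rewrite /psi -{1}[p]cats0; apply: roots_fun_comm_cat => //.
  apply/allP => -[b m] tS; apply: sub_all hp => j /= hj.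
  have /allP/(_ _ tS) := order_path_min seg_ge_trans sS.
  by have := allP posS _ tS; rewrite /seg_pos seg_geE /=; lia.
have psi_cnt z : psi z != 0 -> forall k, cnt k z = cnt k (seg a n.+1).
  move=> nzz k; have := roots_fun_cnt (u := [::]) hom nzz k.
  by rewrite segsw_cons /= !cnt_cat; lia.
have psi_inner z : psi z != 0 -> all (fun j => num a <= num j <= - num a) z.
  move=> nzz; apply/allP => j /cnt_gt0; rewrite (psi_cnt _ nzz) cnt_seg.
  by lia.
have nz_psi : psi (seg a n.+1) != 0.
  rewrite inner; last by apply/allP => j; rewrite mem_seg; lia.
  by rewrite roots_fun_max; [|apply: zero_above_cat].
case/eqP: nz_psi; apply: (flip_seg_zero t_neq0).
- exact: serre_roots_fun.
- exact: flip_roots_fun.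
(* Moved back to the left of all root vectors, a word with first letter above a only produces words
   larger than the maximal one. *)
- move=> i t ia; apply/eqP/negPn/negP => nzt.
  have hin := psi_inner _ nzt; have szt := size_cnt (psi_cnt _ nzt).
  have ai : num a < num i.
    rewrite lt_neqAle (inj_eq num_inj) eq_sym ia.
    by move: hin => /= /andP[/andP[-> _] _].
  have big y : size y = size (segsw S) -> phi ((i :: t) ++ y) = 0.
    move=> sy; apply: za; first by rewrite segsw_cons !size_cat szt sy.
    by rewrite segsw_cons seg_cons /= ai.
  case/eqP: nzt; rewrite inner //.
  rewrite roots_fun_max ?big // => y sy _; exact: big.
(* This case and the next are excluded by weight: of a and -a the segment contains only a, once, and
   it contains neither a-2 nor 2-a. *)
- move=> t; apply/eqP/negPn/negP => nzt.
  have := psi_cnt _ nzt a; rewrite cnt_cons (cnt_cons _ a t) cnt_seg.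
  by rewrite {1 2}/cnt /= eqxx; lia.
- move=> d t e; apply/eqP/negPn/negP => nzt.
  have := psi_cnt _ nzt d; rewrite cnt_cons (cnt_cons _ d t) cnt_seg.
  by rewrite {2}/cnt /= eqxx; have := congr1 num e; rewrite num_shift; lia.
Qed.

End Positivity.

(** * Lyndon factorizations *)

(** Read backwards, a proper left factor begins with a letter of the segment other than its first
    one, hence with a larger letter. *)
Lemma lyndon_segw s : lyndon (rev (segw s)).
Proof.
case: s => a n; rewrite /segw /=; split.
  by rewrite -size_eq0 size_rev size_seg.
move=> u v un vn e; rewrite wltE revK.
have {}e : seg a n.+1 = rev v ++ rev u by rewrite -rev_cat -e revK.
rewrite e; case ev: (rev v) => [|b v'].
  by rewrite -[v]revK ev in vn.
case eu: (rev u) => [|c u']; first by rewrite -[u]revK eu in un.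
move: e; rewrite ev eu seg_cons => -[<- e] /=.
have : c \in seg (shift a 1) n by rewrite e mem_cat mem_head orbT.
by rewrite mem_seg num_shift => h; apply/orP; left; lia.
Qed.

(** If there are two or more segments, the last one gives a proper left factor that is at most the
    first segment, hence smaller than the whole word. *)
Lemma lyndon_segsw S : sorted seg_ge S -> lyndon (rev (segsw S)) ->
  exists s, S = [:: s].
Proof.
case: S => [|s S] sS [ne lt]; first by rewrite eqxx in ne.
move: sS ne lt; case/lastP: S => [|S t] sS ne lt; first by exists s.
have ts : seg_ge s t.
  have /allP := order_path_min seg_ge_trans sS; apply.
  by rewrite mem_rcons mem_head.
have e : segsw (s :: rcons S t) = segsw (s :: S) ++ segw t.
  by rewrite -rcons_cons -cats1 segsw_cat /segsw /= cats0.
have segw_nil r : segw r != [::] by rewrite -size_eq0 size_seg.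
have : wlt (rev (segsw (s :: rcons S t))) (rev (segw t)).
  apply: (lt _ (rev (segsw (s :: S)))); last by rewrite e rev_cat.
    by rewrite -size_eq0 size_rev size_eq0.
  by rewrite segswS -size_eq0 size_rev size_cat addn_eq0 negb_and size_eq0 segw_nil.
rewrite wltE !revK e.
rewrite segswS -catA.
case: (seg_ge_llt ts) => [->|h1].
  by rewrite -[X in llt _ X]cats0 llt_cat2l; case: (_ ++ _).
have h2 : llt (segw s) (segw s ++ segsw S ++ segw t).
  rewrite -{1}[segw s]cats0 llt_cat2l.
  by case: (segsw S) => //; have := segw_nil t; case: (segw t).
move=> h3; have := llt_trans h1 (llt_trans h2 h3); by rewrite llt_irr.
Qed.

(** Equal neighbours are collected into powers. The clause on [ohead] lets the induction decide
    whether the next word joins the first power. *)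
Lemma lyndon_fact_group (L : seq word) : (forall w, w \in L -> lyndon w) ->
  sorted wle L -> exists f, is_lyndon_fact (flatten L) f /\
    ohead (map fst f) = ohead L.
Proof.
elim: L => [|w L IH] lyn sL; first by exists [::].
have [|f [[f1 f2 f3] f4]] := IH _ (path_sorted sL).
  by move=> v vL; apply: lyn; rewrite inE vL orbT.
case: L => [|v L] in IH lyn sL f3 f4 *.
  exists [:: (w, 1%N)]; split=> //; split=> [p||] /=; rewrite ?cats0 //.
  by rewrite inE => /eqP->; split=> //; apply: lyn; rewrite mem_head.
case: f => [//|[v' m] f] /= in f1 f2 f3 f4 *; case: f4 => f4; subst v'.
have [e|ne] := eqVneq w v.
  subst w; exists ((v, m.+1) :: f); split=> //; split=> [p||] //=.
  - rewrite inE => /orP[/eqP->|pf]; last by apply: f1; rewrite inE pf orbT.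
    by split=> //; apply: lyn; rewrite mem_head.
  - by rewrite f3 -catA.
exists [:: (w, 1%N), (v, m) & f]; split=> //; split=> [p||] /=.
- rewrite inE => /orP[/eqP->|/f1//].
  by split=> //; apply: lyn; rewrite mem_head.
- by rewrite f2 andbT /wlt ne; case/andP: sL.
- by rewrite f3 cats0.
Qed.

(** [lyndon_fact] is a choice among factorizations, so it is enough to exhibit one, and the segments
    provide it. *)
Lemma lyndon_fact_segsw S : sorted seg_ge S ->
  is_lyndon_fact (rev (segsw S)) (lyndon_fact (rev (segsw S))).
Proof.
move=> sS; apply: (@xgetPex _ _ [set f | is_lyndon_fact (rev (segsw S)) f]).
have [||f [hf _]] := @lyndon_fact_group [seq rev (segw s) | s <- rev S].
- by move=> w /mapP[s _ ->]; apply: lyndon_segw.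
- rewrite sorted_map rev_sorted; apply: sub_sorted sS => s t st /=.
  rewrite wleE !revK; case: (seg_ge_llt st) => [->|->]; last by rewrite orbT.
  by rewrite eqxx.
exists f; move: hf; rewrite (_ : flatten _ = rev (segsw S)) //.
elim: (S) => // s T IH; rewrite rev_cons map_rcons flatten_rcons IH.
by rewrite segswS rev_cat.
Qed.

(** Each segment remembers the Lyndon factor it comes from, so that symmetry of the factors passes
    to the segments. *)
Lemma segs_of_factors (f : seq (word * nat)) :
  (forall p, p \in f -> exists s, p.1 = rev (segw s)) -> sorted wlt (map fst f) ->
  exists S, [/\ rev (flatten [seq flatten (nseq p.2 p.1) | p <- f]) = segsw S,
    sorted seg_ge S
    & forall s, s \in S -> exists2 p, p \in f & p.1 = rev (segw s)].
Proof.
elim: f => [|[w m] f IH] hf sf; first by exists [::].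
have [|S [eS sS hS]] := IH _ (path_sorted sf).
  by move=> p pf; apply: hf; rewrite inE pf orbT.
have [s /= ew] := hf _ (mem_head _ _).
exists (S ++ nseq m s); split.
- rewrite /= rev_cat eS segsw_cat ew; congr (_ ++ _).
  by rewrite rev_flatten map_nseq rev_nseq revK /segsw map_nseq.
- have tr := seg_ge_trans; rewrite sorted_pairwise // pairwise_cat.
  rewrite -sorted_pairwise // sS /=; apply/andP; split.
    apply/allrelP => s1 s2 s1S /nseqP[-> _].
    have [p pf ep] := hS _ s1S; apply: llt_seg_ge.
    have wlt_trans : transitive wlt.
      by move=> y x z; rewrite !wltE; apply: llt_trans.
    have /allP/(_ p.1) := order_path_min wlt_trans sf.
    by rewrite map_f // ep ew wltE !revK => ->.
  elim: (m) => //= k ->; rewrite andbT; apply/allP => t /nseqP[-> _].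
  by rewrite /seg_ge eqxx leqnn orbT.
move=> t; rewrite mem_cat => /orP[/hS[p pf ep]|/nseqP[-> _]].
  by exists p => //; rewrite inE pf orbT.
by exists (w, m) => //; rewrite mem_head.
Qed.

(** * Linear maps on free algebras and their quotients *)

Section FreeLinear.
Variables (F : fieldType) (X : choiceType) (M : lmodType F) (l : seq X -> M).
Implicit Types x y : freeAlg F X.

Definition free_lin x : M := \sum_(m <- msupp x) x@_m *: l m.

Lemma free_linEw (d : {fset {fmonom X}}) x : (msupp x `<=` d)%fset ->
  free_lin x = \sum_(m <- d) x@_m *: l m.
Proof.
move=> le; rewrite [LHS](big_fset_incl _ le) // => m _ /mcoeff_outdom ->.
by rewrite scale0r.
Qed.

Lemma free_lin_is_linear : linear free_lin.
Proof.
move=> c x y; pose d := (msupp x `|` msupp y)%fset.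
rewrite !(@free_linEw d) ?fsubsetUl ?fsubsetUr //.
  by rewrite scaler_sumr -big_split; apply: eq_bigr => m _;
    rewrite mcoeffD mcoeffZ scalerDl scalerA.
apply: fsubset_trans (msuppD_le _ _) _.
by rewrite fsetSU // msuppZ_le.
Qed.

HB.instance Definition _ :=
  GRing.isLinear.Build F (freeAlg F X) M *:%R free_lin free_lin_is_linear.

Definition monom (w : seq X) : freeAlg F X := << FMonom w >>.

Lemma free_lin_monom w : free_lin (monom w) = l w.
Proof.
rewrite (@free_linEw [fset FMonom w]%fset) ?msuppU_le //.
by rewrite big_seq_fset1 mcoeffUU scale1r.
Qed.

End FreeLinear.

Section FreeMonomials.
Variables (F : fieldType) (X : choiceType).
Implicit Types x y : freeAlg F X.

Lemma freeAlgE x : x = \sum_(m <- msupp x) x@_m *: monom F (m : seq X).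
Proof.
rewrite {1}[x]monalgE; apply: eq_bigr => m _; rewrite /monom fmK.
rewrite [RHS](malgZ_def x@_m) /fgscale.
by rewrite (big_fset_incl _ (msuppU_le : (_ `<=` [fset m])%fset)) ?big_seq_fset1 ?mcoeffUU
  ?mulr1 // => k _ /mcoeff_outdom->; rewrite mulr0 monalgU0.
Qed.

Lemma monomM u v : monom F u * monom F v = monom F (u ++ v) :> freeAlg F X.
Proof.
rewrite [LHS]malgM_def fgmulUU mulr1; congr << 1 *g _ >>.
by apply: val_inj; rewrite /= fmM.
Qed.

Lemma monom0 : monom F [::] = 1 :> freeAlg F X.
Proof.
congr << 1 *g _ >>; by apply: val_inj; rewrite /= fm1.
Qed.

Lemma genE i : gen i = monom F [:: i] :> freeAlg F X.
Proof. by rewrite /gen fmuE. Qed.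

Lemma free_expand (M : lmodType F) (f : freeAlg F X -> M) x : linear f ->
  f x = \sum_(m <- msupp x) x@_m *: f (monom F (m : seq X)).
Proof.
move=> lf; pose g := HB.pack_for {linear freeAlg F X -> M} f
  (GRing.isLinear.Build F (freeAlg F X) M *:%R f lf).
rewrite -[f]/(g : _ -> _) {1}[x]freeAlgE linear_sum.
by apply: eq_bigr => m _; rewrite linearZ.
Qed.

Lemma free_lin_mul (M : lmodType F) (l : seq X -> M) a r b :
  free_lin l (a * r * b) = \sum_(m <- msupp a) \sum_(n <- msupp b)
    (a@_m * b@_n) *: free_lin (fun w => l ((m : seq X) ++ w ++ (n : seq X))) r.
Proof.
rewrite (free_expand (f := fun x => free_lin l (x * r * b))); last first.
  by move=> c x y; rewrite !mulrDl -!scalerAl linearP.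
apply: eq_bigr => m _.
rewrite (free_expand (f := fun x => free_lin l (monom F m * r * x))); last first.
  by move=> c x y; rewrite mulrDr -scalerAr linearP.
rewrite scaler_sumr; apply: eq_bigr => n _; rewrite scalerA; congr (_ *: _).
rewrite (free_expand (f := fun x => free_lin l (monom F m * x * monom F n))); last first.
  by move=> c x y; rewrite mulrDr mulrDl -scalerAr -scalerAl linearP.
by apply: eq_bigr => w _; rewrite !monomM free_lin_monom catA.
Qed.

Lemma free_lin_commutator (M : lmodType F) (l : seq X -> M) i j :
  free_lin l (gen i * gen j - gen j * gen i) = l [:: i; j] - l [:: j; i].
Proof. by rewrite !genE !monomM linearB /= !free_lin_monom. Qed.

Lemma free_lin_serre (M : lmodType F) (l : seq X -> M) c i j :
  free_lin l (gen i ^+ 2 * gen j - c *: (gen i * gen j * gen i) + gen j * gen i ^+ 2)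
  = l [:: i; i; j] - c *: l [:: i; j; i] + l [:: j; i; i].
Proof.
by rewrite !expr2 !genE !monomM linearD linearB linearZ /= !free_lin_monom.
Qed.

End FreeMonomials.

Section QuotLinear.
Variables (F : fieldType) (X : choiceType) (R : set (freeAlg F X)).

Lemma qprojD x y : qproj R (x + y) = qproj R x + qproj R y.
Proof. exact/esym/qproj_add. Qed.

Lemma qprojZ c x : qproj R (c *: x) = c *: qproj R x.
Proof. exact/esym/qproj_scale. Qed.

Lemma qprojM x y : qproj R (x * y) = qproj R x * qproj R y.
Proof. exact/esym/qproj_mul. Qed.

Lemma qproj0 : qproj R 0 = 0.
Proof. by apply: (addrI (qproj R 0)); rewrite -qprojD !addr0. Qed.

Lemma qproj_sum (I : Type) (s : seq I) (c : I -> F) (x : I -> freeAlg F X) :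
  qproj R (\sum_(i <- s) c i *: x i) = \sum_(i <- s) c i *: qproj R (x i).
Proof.
elim: s => [|i s IH].
  by rewrite !big_nil qproj0.
by rewrite !big_cons qprojD qprojZ IH.
Qed.

Lemma quot_spanE (x : quotAlg R) : x = \sum_(m <- msupp (qlift x : freeAlg F X))
  (qlift x : freeAlg F X)@_m *: qproj R (monom F (m : seq X)).
Proof. by rewrite -[LHS]qliftK {1}[qlift x]freeAlgE qproj_sum. Qed.

Lemma qproj_monom w : qproj R (monom F w) = \prod_(i <- w) qproj R (gen i).
Proof.
elim: w => [|i w IH]; first by rewrite big_nil monom0.
by rewrite big_cons -IH genE; rewrite -qprojM monomM.
Qed.

Definition quot_lin (M : lmodType F) (l : seq X -> M) (x : quotAlg R) : M :=
  free_lin l (qlift x).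

(** Vanishing of the linear extension of [l] on the two-sided ideal of [R], tested with words on
    both sides of a relation. *)
Definition kills (M : lmodType F) (l : seq X -> M) : Prop :=
  forall m r n, R r -> free_lin (fun w => l (m ++ w ++ n)) r = 0.

Variables (M : lmodType F) (l : seq X -> M).
Hypothesis lR : kills l.

(** Two representatives differ by a sum of products of the form a r b with [r] in [R], which expand
    into words around [r]. *)
Lemma quot_lin_qproj x : quot_lin l (qproj R x) = free_lin l x.
Proof.
apply/eqP; rewrite -subr_eq0 -linearB; apply/eqP.
have /asboolP[s [sR ->]] := qliftB R x.
rewrite linear_sum big_seq big1 // => t ts; rewrite /= free_lin_mul big1 // => m _.
by rewrite big1 // => n _; rewrite lR ?scaler0 //; apply: sR.
Qed.

Lemma quot_linD x y : quot_lin l (x + y) = quot_lin l x + quot_lin l y.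
Proof.
by rewrite -[x in LHS]qliftK -[y in LHS]qliftK -qprojD quot_lin_qproj linearD.
Qed.

Lemma quot_linZ c x : quot_lin l (c *: x) = c *: quot_lin l x.
Proof.
rewrite -[x in LHS]qliftK.
by rewrite -qprojZ quot_lin_qproj linearZ.
Qed.

Lemma quot_lin_monom w : quot_lin l (\prod_(i <- w) qproj R (gen i)) = l w.
Proof. by rewrite -qproj_monom quot_lin_qproj free_lin_monom. Qed.

End QuotLinear.

Section SerreKills.
Variables (M : lmodType K) (l : seq J -> M).

Definition serre_map : Prop :=
  (forall p i j s, dotJ i j = 0 -> l (p ++ [:: i, j & s]) = l (p ++ [:: j, i & s])) /\
  (forall p i j s, dotJ i j = -1 ->
     l (p ++ [:: i, i, j & s]) - (q + q^-1) *: l (p ++ [:: i, j, i & s])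
     + l (p ++ [:: j, i, i & s]) = 0).

Lemma serre_kills : serre_map -> kills (serre (@gen K J)) l.
Proof.
move=> [h1 h2] m r n; case=> {r} i j ij.
  apply: etrans (free_lin_commutator _ i j) _.
  by rewrite /= h1 ?subrr.
apply: etrans (free_lin_serre _ _ i j) _; exact: h2.
Qed.

End SerreKills.

(** * Quantum numbers and weights of words *)

Lemma q_pow_neq1 n : q ^+ n.+1 != 1.
Proof.
rewrite -rmorphXn -tofrac1 tofrac_eq; apply/eqP => /(congr1 (fun p : {poly rat} => size p)).
by rewrite size_polyXn size_poly1.
Qed.

Lemma q_neq0 : q != 0.
Proof. by rewrite tofrac_eq0 polyX_eq0. Qed.

Section NotRootOfUnity.
Variables (F : fieldType) (x : F).
Hypotheses (x0 : x != 0) (x1 : forall n, x ^+ n.+1 != 1).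

(** Otherwise x^2 = -1 and x^4 = 1. *)
Lemma addV_neq0 : x + x^-1 != 0.
Proof.
apply: contra (x1 3) => /eqP e.
have : x ^+ 2 = -1 by apply: (mulIf (invr_neq0 x0)); rewrite expr2 mulfK // mulN1r;
  apply/eqP; rewrite -addr_eq0 e.
by move=> e2; rewrite (exprM x 2 2) e2 sqrrN expr1n.
Qed.

Lemma subXV_neq0 n : x ^+ n.+1 - x ^- n.+1 != 0.
Proof.
apply: contra (x1 (n + n).+1) => /eqP e.
rewrite -addSn -addnS exprD -[X in X * _](subrK (x ^- n.+1)) e add0r.
by rewrite mulVf // expf_neq0.
Qed.

Lemma qnumber_neq0 n : (x ^+ n.+1 - x ^- n.+1) / (x - x^-1) != 0.
Proof. by rewrite mulf_neq0 ?subXV_neq0 // invr_neq0 //; apply: (subXV_neq0 0). Qed.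

End NotRootOfUnity.

Lemma q_addV_neq0 : q + q^-1 != 0.
Proof. exact: addV_neq0 q_neq0 q_pow_neq1. Qed.

Lemma qint_neq0 n : qint n.+1 != 0.
Proof. exact: qnumber_neq0 q_neq0 q_pow_neq1 n. Qed.

Lemma prodf_nat_neq0 (F : fieldType) n (f : nat -> F) :
  (forall k, f k.+1 != 0) -> \prod_(1 <= k < n.+1) f k != 0.
Proof.
move=> h; rewrite big_nat prodf_seq_neq0; apply/allP => k _ /=.
by apply/implyP; case: k => // k _; apply: h.
Qed.

Lemma kappa_neq0 w : kappa w != 0.
Proof.
rewrite /kappa prodf_seq_neq0; apply/allP => p _ /=.
by case: ifP => _; apply: prodf_nat_neq0 => k; rewrite ?doubleS; apply: qint_neq0.
Qed.

Lemma thetaJK : involutive thetaJ.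
Proof. by move=> k; apply: num_inj; rewrite !num_theta opprK. Qed.

Lemma wt_coef k w : (wt w)@_k = (count_mem k w)%:Z.
Proof.
rewrite /wt; elim: w => [|i w IH]; first by rewrite big_nil mcoeff0.
by rewrite big_cons mcoeffD IH /alpha mcoeffU /= PoszD natz.
Qed.

Lemma thetaQ_coef (x : rootQ) k : (thetaQ x)@_k = x@_(thetaJ k).
Proof.
rewrite /thetaQ raddf_sum /=.
have step i : (<< x@_i *g thetaJ i >> : rootQ)@_k = x@_i *+ (i == thetaJ k).
  by rewrite mcoeffU; congr (_ *+ _); congr nat_of_bool; apply/eqP/eqP => [<-|->];
    rewrite thetaJK.
rewrite (eq_bigr _ (fun i _ => step i)).
have [kx|kx] := boolP (thetaJ k \in msupp x).
  rewrite (bigD1_seq _ kx) ?fset_uniq //= eqxx mulr1n big1 ?addr0 // => i.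
  by move/negPf->; rewrite mulr0n.
rewrite big_seq big1 ?mcoeff_outdom // => i ix.
by have /negPf-> : i != thetaJ k; [apply: contra kx => /eqP<-|rewrite mulr0n].
Qed.

Lemma twt_coef k w : (twt w)@_k = (cnt k w)%:Z.
Proof. by rewrite /twt /symQ mcoeffD thetaQ_coef !wt_coef -PoszD. Qed.

Lemma twtP u v : twt u = twt v <-> forall k, cnt k u = cnt k v.
Proof.
split=> [e k|e]; first by apply/eqP; rewrite -eqz_nat -!twt_coef e.
by apply/malgP => k; rewrite !twt_coef e.
Qed.

Lemma twt_cat u v : twt (u ++ v) = twt u + twt v.
Proof. by apply/malgP => k; rewrite [RHS]mcoeffD !twt_coef cnt_cat PoszD. Qed.

Lemma twt_cons i u : twt (i :: u) = twt [:: i] + twt u.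
Proof. by rewrite -cat1s twt_cat. Qed.

Lemma twt_theta i : twt [:: thetaJ i] = twt [:: i].
Proof.
apply/twtP => k; rewrite /cnt /= !addn0 addnC; congr addn; congr nat_of_bool.
  by apply/eqP/eqP => [/(congr1 thetaJ)|->]; rewrite ?thetaJK.
by apply/eqP/eqP => [<-|->]; rewrite ?thetaJK.
Qed.

Lemma twt_rev w : twt (rev w) = twt w.
Proof. by apply/twtP => k; rewrite cnt_rev. Qed.

Lemma twt_eq0 w : twt w = twt [::] -> w = [::].
Proof. by move/twtP/size_cnt/size0nil. Qed.

Lemma size_twt u v : twt u = twt v -> size u = size v.
Proof. by move/twtP/size_cnt. Qed.

(** Words of one weight have the same length, and their letters are among those of any one of them
    and the flips of these. *)
Lemma twt_finite (beta : rootQ) : finite_set [set w | twt w = beta].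
Proof.
have [[w0 <-]|none] := pselect (exists w, twt w = beta); last first.
  by apply: (sub_finite_set _ (finite_set0 _)) => w hw; apply: none; exists w.
have hfin n : finite_set [set w : word | size w = n /\
    {subset w <= w0 ++ map thetaJ w0}].
  elim: n => [|n IH].
    apply: (sub_finite_set _ (finite_set1 [::])) => w [/size0nil -> _] //.
  apply: (@sub_finite_set _ _ [set i :: w | i in [set` w0 ++ map thetaJ w0] &
    w in [set w | size w = n /\ {subset w <= w0 ++ map thetaJ w0}]]); last first.
    apply: finite_image2 => //; exact: finite_seq.
  case=> [[//]|i w [[sw] hw]]; exists i; first by apply: hw; rewrite mem_head.
  by exists w => //; split=> // j jw; apply: hw; rewrite inE jw orbT.
apply: sub_finite_set (hfin (size w0)) => w e; split; first exact: size_twt.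
move=> j /cnt_gt0; move/twtP: e => ->; rewrite /cnt addn_gt0 -!has_count !has_pred1.
rewrite mem_cat => /orP[->//|h]; apply/orP; right.
by apply/mapP; exists (thetaJ j) => //; rewrite thetaJK.
Qed.

Local Opaque K q gen.

Lemma fword_nil : fword [::] = 1. Proof. exact: big_nil. Qed.

Lemma fword_cons i w : fword (i :: w) = f_ i * fword w.
Proof. exact: big_cons. Qed.

Lemma fword_cat u v : fword (u ++ v) = fword u * fword v.
Proof. exact: big_cat. Qed.

Lemma fword_spanE (x : fAlg) : exists s : seq (K * word),
  x = \sum_(t <- s) t.1 *: fword t.2.
Proof.
exists [seq ((qlift x : freeAlg K J)@_m, m : word) | m <- msupp (qlift x : freeAlg K J)].
rewrite big_map; apply: etrans (quot_spanE x) _.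
by apply: eq_bigr => m _; rewrite /= qproj_monom.
Qed.

(** * The module theta-V *)

Section AlgebraAction.
Variables (F : fieldType) (B : algType F) (M : lmodType F) (act : B -> M -> M).
Hypothesis actD : forall x y v, act (x + y) v = act x v + act y v.
Hypothesis actZ : forall c x v, act (c *: x) v = c *: act x v.
Hypothesis actM : forall x y v, act (x * y) v = act x (act y v).
Hypothesis act1 : forall v, act 1 v = v.
Implicit Types (x y z : B) (v : M).

Lemma actB x y v : act (x - y) v = act x v - act y v.
Proof. by rewrite actD -[- y]scaleN1r actZ scaleN1r. Qed.

Lemma act_inverse x y v : act (x * y - 1) v = act x (act y v) - v.
Proof. by rewrite actB actM act1. Qed.

Lemma act_commutator x y v :
  act (x * y - y * x) v = act x (act y v) - act y (act x v).
Proof. by rewrite actB !actM. Qed.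

Lemma act_conjugate c x y z v :
  act (x * y * z - c *: y) v = act x (act y (act z v)) - c *: act y v.
Proof. by rewrite actB !actM actZ. Qed.

Lemma act_serre c x y v :
  act (x ^+ 2 * y - c *: (x * y * x) + y * x ^+ 2) v =
  act x (act x (act y v)) - c *: act x (act y (act x v))
  + act y (act x (act x v)).
Proof. by rewrite !expr2 actD actB actZ !actM. Qed.

Lemma act_boson c (d e : bool) x y z v :
  act (x * y - (c *: (y * x) + d%:R + (if e then z else 0))) v =
  act x (act y v) - (c *: act y (act x v) + d%:R *: v + (if e then act z v else 0)).
Proof.
have act0 w : act 0 w = 0 by rewrite -(scale0r 0) actZ scale0r.
rewrite actB !actD actZ !actM; congr (_ - (_ + _ + _)); last by case: e.
by case: d; rewrite ?act1 ?scale1r // act0 scale0r.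
Qed.

End AlgebraAction.

Section EKAction.
Variable V : ekModule.
Implicit Types (u v : V) (i j : J).

Definition ekfree (x : freeAlg K ekgen) (v : V) : V :=
  ekact (qproj _ x : EK) v.

(** Scaling a vector is acting by a multiple of 1, which commutes with every element of the
    algebra. *)
Lemma ekact_is_linear (a : EK) : linear (ekact a : V -> V).
Proof.
move=> c u v; rewrite ekactDr; congr (_ + _).
have -> : c *: u = ekact (c *: (1 : EK)) u by rewrite ekactZ ekact1.
rewrite -ekactM -ekactZ; congr (ekact _ u).
by apply: etrans (esym (scale_pAr c a 1)) _; rewrite mulr1.
Qed.

HB.instance Definition _ (a : EK) :=
  GRing.isLinear.Build K V V *:%R (ekact a) (ekact_is_linear a).

HB.instance Definition _ i := GRing.isLinear.Build K V V *:%R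
  (@opE V i) (ekact_is_linear _).
HB.instance Definition _ i := GRing.isLinear.Build K V V *:%R
  (@opF V i) (ekact_is_linear _).
HB.instance Definition _ i := GRing.isLinear.Build K V V *:%R
  (@opT V i) (ekact_is_linear _).

Lemma ekact0l u : ekact (0 : EK) u = 0.
Proof. by apply: (addrI (ekact (0 : EK) u)); rewrite -ekactDl !addr0. Qed.

Lemma ekact_sum (I : Type) (s : seq I) (c : I -> K) (a : I -> EK) u :
  ekact (\sum_(k <- s) c k *: a k) u = \sum_(k <- s) c k *: ekact (a k) u.
Proof.
elim: s => [|k s IH]; first by rewrite !big_nil ekact0l.
by rewrite !big_cons ekactDl ekactZ IH.
Qed.

Lemma ekfreeD x y v : ekfree (x + y) v = ekfree x v + ekfree y v.
Proof. exact: etrans (congr1 (fun a => ekact (a : EK) v) (qprojD _ x y)) (ekactDl _ _ _). Qed.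

Lemma ekfreeZ c x v : ekfree (c *: x) v = c *: ekfree x v.
Proof. exact: etrans (congr1 (fun a => ekact (a : EK) v) (qprojZ _ c x)) (ekactZ _ _ _). Qed.

Lemma ekfreeM x y v : ekfree (x * y) v = ekfree x (ekfree y v).
Proof. exact: etrans (congr1 (fun a => ekact (a : EK) v) (qprojM _ x y)) (ekactM _ _ _). Qed.

Lemma ekfree1 v : ekfree 1 v = v.
Proof. exact: ekact1. Qed.

Lemma ekfree_rel x v : ekrel x -> ekfree x v = 0.
Proof. by move=> rx; rewrite /ekfree (qproj_rel rx) qproj0 ekact0l. Qed.

Definition opTinv (i : J) : V -> V := ekact (qproj _ (gen (gTinv i)) : EK).
HB.instance Definition _ i := GRing.isLinear.Build K V V *:%R
  (opTinv i) (ekact_is_linear _).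

Lemma opTK i v : opTinv i (opT i v) = v.
Proof.
apply: subr0_eq; apply: etrans (ekfree_rel v (ek_TinvT i)).
exact/esym/(act_inverse ekfreeD ekfreeZ ekfreeM ekfree1).
Qed.

Lemma opTVK i v : opT i (opTinv i v) = v.
Proof.
apply: subr0_eq; apply: etrans (ekfree_rel v (ek_TTinv i)).
exact/esym/(act_inverse ekfreeD ekfreeZ ekfreeM ekfree1).
Qed.

Lemma opT_theta i v : opT (thetaJ i) v = opT i v.
Proof.
apply: subr0_eq; apply: etrans (ekfree_rel v (ek_thetaT i)).
exact/esym/(actB ekfreeD ekfreeZ).
Qed.

Lemma opT_opF i j v : opT i (opF j v) =
  q ^ (- dotQ (alpha i + alpha (thetaJ i)) (alpha j)) *: opF j (opT i v).
Proof.
rewrite -{1}(opTK i v); apply: subr0_eq.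
apply: etrans (ekfree_rel (opT i v) (ek_TF i j)).
exact/esym/(act_conjugate ekfreeD ekfreeZ ekfreeM).
Qed.

Lemma opE_opF i j v : opE i (opF j v) = q ^ (- dotJ i j) *: opF j (opE i v)
  + (i == j)%:R *: v + (if thetaJ i == j then opT i v else 0).
Proof.
apply: subr0_eq; apply: etrans (ekfree_rel v (ek_EF i j)).
exact/esym/(act_boson ekfreeD ekfreeZ ekfreeM ekfree1).
Qed.

Lemma opF_comm i j v : dotJ i j = 0 -> opF i (opF j v) = opF j (opF i v).
Proof.
move=> ij; apply: subr0_eq; apply: etrans (ekfree_rel v (ek_serreF (serre0 _ ij))).
exact/esym/(act_commutator ekfreeD ekfreeZ ekfreeM).
Qed.

Lemma opF_serre i j v : dotJ i j = -1 ->
  opF i (opF i (opF j v)) - (q + q^-1) *: opF i (opF j (opF i v))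
  + opF j (opF i (opF i v)) = 0.
Proof.
move=> ij; apply: etrans (ekfree_rel v (ek_serreF (serre1 _ ij))).
exact/esym/(act_serre ekfreeD ekfreeZ ekfreeM).
Qed.

Definition Fop (w : seq J) (v : V) : V := foldr (@opF V) v w.

Lemma Fop_cat p s v : Fop (p ++ s) v = Fop p (Fop s v).
Proof. exact: foldr_cat. Qed.

Lemma Fop_is_linear p : linear (Fop p).
Proof. by elim: p => // i p IH c x y; rewrite /Fop /= -!/(Fop _ _) IH linearP. Qed.

HB.instance Definition _ p := GRing.isLinear.Build K V V *:%R (Fop p) (Fop_is_linear p).

Lemma serre_Fop v : serre_map (fun w => Fop w v).
Proof.
split=> p i j s ij; rewrite !Fop_cat; set w := Fop s v.
  by congr (Fop p _); apply: opF_comm.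
rewrite -linearZ -linearB -linearD -[RHS](linear0 (Fop p)).
congr (Fop p _); exact: opF_serre.
Qed.

Lemma f_actE x v : f_act x v = quot_lin (fun w => Fop w v) x.
Proof.
rewrite /f_act /evalAlg ekact_sum /quot_lin /free_lin; apply: eq_bigr => m _.
congr (_ *: _); elim: (m : seq J) => [|i w IH]; first by rewrite big_nil ekact1.
by rewrite big_cons ekactM IH.
Qed.

Lemma f_act_fword w v : f_act (fword w) v = Fop w v.
Proof. by rewrite f_actE [LHS]quot_lin_monom //; apply/serre_kills/serre_Fop. Qed.

Lemma f_actD x y v : f_act (x + y) v = f_act x v + f_act y v.
Proof. by rewrite !f_actE quot_linD //; apply/serre_kills/serre_Fop. Qed.

Lemma f_actZ c x v : f_act (c *: x) v = c *: f_act x v.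
Proof. by rewrite !f_actE quot_linZ //; apply/serre_kills/serre_Fop. Qed.

Lemma f_act_sum (I : Type) (s : seq I) (c : I -> K) (x : I -> fAlg) v :
  f_act (\sum_(k <- s) c k *: x k) v = \sum_(k <- s) c k *: f_act (x k) v.
Proof.
elim: s => [|k s IH].
  by rewrite !big_nil -(scale0r (0 : fAlg)) f_actZ scale0r.
by rewrite !big_cons f_actD f_actZ IH.
Qed.

End EKAction.

(** * The action through sigma and the root vectors *)

Lemma serre_map_rev (M : lmodType K) (l : seq J -> M) :
  serre_map l -> serre_map (fun w => l (rev w)).
Proof.
have r2 p i j s : rev (p ++ [:: i, j & s]) = rev s ++ [:: j, i & rev p].
  by rewrite rev_cat !rev_cons -!cats1 -!catA.
have r3 p i j k s : rev (p ++ [:: i, j, k & s]) = rev s ++ [:: k, j, i & rev p].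
  by rewrite rev_cat !rev_cons -!cats1 -!catA.
move=> [h1 h2]; split=> p i j s ij.
  by rewrite !r2 h1 // dotJC.
(* Reversal fixes the middle term of the Serre relation and exchanges the outer ones. *)
rewrite !r3 -[RHS](h2 (rev s) i j (rev p) ij) addrC addrA [in LHS]addrAC.
by rewrite addrAC.
Qed.

Lemma prod_scale (I : Type) (s : seq I) (c : I -> K) (x : I -> fAlg) :
  \prod_(k <- s) (c k *: x k) = (\prod_(k <- s) c k) *: \prod_(k <- s) x k.
Proof.
elim: s => [|k s IH]; first by rewrite !big_nil scale1r.
rewrite !big_cons IH; apply: etrans (esym (scale_pAl _ _ _)) _.
by rewrite -scalerA; congr (_ *: _); apply/esym/scale_pAr.
Qed.

Section RootVectors.
Variable V : ekModule.
Implicit Types (u v : V) (i j : J) (w : word).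

(* The action of [sigma x]; as sigma is an anti-automorphism, the factors of a
   product act from left to right. *)
Definition sact (x : fAlg) v : V := f_act (sigma x) v.

Lemma sactE x v : sact x v = quot_lin (fun w => Fop (rev w) v) x.
Proof.
by rewrite /sact /sigma f_act_sum; apply: eq_bigr => m _; rewrite f_act_fword.
Qed.

Lemma sact_kills v : kills (serre (@gen K J)) (fun w => Fop (rev w) v).
Proof. exact/serre_kills/serre_map_rev/serre_Fop. Qed.

Lemma sactD x y v : sact (x + y) v = sact x v + sact y v.
Proof. by rewrite !sactE quot_linD //; apply: sact_kills. Qed.

Lemma sactZ c x v : sact (c *: x) v = c *: sact x v.
Proof. by rewrite !sactE quot_linZ //; apply: sact_kills. Qed.

Lemma sact_fword w v : sact (fword w) v = Fop (rev w) v.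
Proof. by rewrite sactE [LHS]quot_lin_monom //; apply: sact_kills. Qed.

Lemma sact_sum (I : Type) (s : seq I) (c : I -> K) (x : I -> fAlg) v :
  sact (\sum_(k <- s) c k *: x k) v = \sum_(k <- s) c k *: sact (x k) v.
Proof.
elim: s => [|k s IH].
  by rewrite !big_nil -(scale0r (0 : fAlg)) sactZ scale0r.
by rewrite !big_cons sactD sactZ IH.
Qed.

Lemma sact_span (s : seq (K * word)) v :
  sact (\sum_(t <- s) t.1 *: fword t.2) v = \sum_(t <- s) t.1 *: Fop (rev t.2) v.
Proof.
apply: etrans (sact_sum _ _ _ _) _; apply: eq_bigr => t _.
by congr (_ *: _); apply: sact_fword.
Qed.

Lemma sactM_fword x w v : sact (x * fword w) v = Fop (rev w) (sact x v).
Proof.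
have [s ->] := fword_spanE x; rewrite mulr_suml.
have -> : \sum_(j <- s) j.1 *: fword j.2 * fword w
    = \sum_(j <- s) j.1 *: fword (j.2 ++ w).
  by apply: eq_bigr => j _; rewrite fword_cat; apply/esym/scale_pAl.
apply: etrans (sact_sum _ _ _ _) _.
apply: etrans (esym (congr1 (Fop (rev w)) (sact_span s v))).
rewrite linear_sum; apply: eq_bigr => j _; rewrite linearZ.
apply: (congr1 (fun z => j.1 *: z)).
by apply: etrans (sact_fword _ _) _; rewrite rev_cat; apply: Fop_cat.
Qed.

Lemma sactM x y v : sact (x * y) v = sact y (sact x v).
Proof.
have [t ->] := fword_spanE y; rewrite mulr_sumr.
have -> : \sum_(i <- t) x * (i.1 *: fword i.2) = \sum_(i <- t) i.1 *: (x * fword i.2).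
  by apply: eq_bigr => i _; apply/esym/scale_pAr.
apply: etrans (sact_sum _ _ _ _) _; apply: etrans (esym (sact_span _ _)).
apply: eq_bigr => i _; apply: (congr1 (fun z => i.1 *: z)); exact: sactM_fword.
Qed.

Lemma sact_f i v : sact (f_ i) v = opF i v.
Proof. by rewrite -(mulr1 (f_ i)) -fword_nil -fword_cons sact_fword. Qed.

Lemma sact1 v : sact 1 v = v.
Proof. by rewrite -fword_nil sact_fword. Qed.

Lemma sact_rootP i w v : w != [::] -> sact (Defs.rootP (i :: w)) v =
  sact (Defs.rootP w) (opF i v) - q *: opF i (sact (Defs.rootP w) v).
Proof.
case: w => // j w _.
have -> : Defs.rootP [:: i, j & w] = f_ i * Defs.rootP (j :: w) + - q *: (Defs.rootP
  (j :: w) * f_ i).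
  by rewrite scaleNr.
rewrite sactD sactZ [X in X + _]sactM sact_f scaleNr; congr (_ - _ *: _).
by apply: etrans (sactM _ _ _) _; apply: sact_f.
Qed.

Lemma divP_prod (f : seq (word * nat)) :
  \prod_(p <- f) divP p.1 p.2 =
  (\prod_(p <- f) (if lsym p.1 then qdfact p.2 else qfact p.2))^-1 *:
    \prod_(w <- flatten [seq nseq p.2 p.1 | p <- f]) Defs.rootP w.
Proof.
rewrite prod_scale prodfV; congr (_ *: _).
elim: f => [|[w n] f IH]; first by rewrite !big_nil.
rewrite big_cons big_cat IH /=; congr (_ * _).
by elim: n => [|n IHn]; rewrite ?big_nil // big_cons -IHn exprS.
Qed.

End RootVectors.

(** * The bilinear form and its functionals on words *)

Section ThetaModule.
Variables (V : ekModule) (v0 : V) (form : V -> V -> K).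
Hypotheses (hV : is_thetaV v0) (h_form : is_form v0 form).
Implicit Types (u v : V) (i j : J) (x y : seq J) (w : word).

Definition fvec x : V := Fop x v0.
Definition Eop x u : V := foldr (@opE V) u x.

(** Up to reversal of the word, these are the coefficients of [thetaPsi u]; see [thetaPsi_coef]. *)
Definition phi u x : K := form u (fvec x).

Lemma vformDr u v v' : form u (v + v') = form u v + form u v'.
Proof.
by rewrite !(form_sym h_form u) -{1}(scale1r v) (form_linear h_form) mul1r.
Qed.

Lemma vform0r u : form u 0 = 0.
Proof. by apply: (addrI (form u 0)); rewrite -vformDr !addr0. Qed.

Lemma vformZr u c v : form u (c *: v) = c * form u v.
Proof.
rewrite !(form_sym h_form u) -(addr0 (c *: v)) (form_linear h_form).
by rewrite (form_sym h_form 0) vform0r addr0.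
Qed.

Lemma vformBr u v v' : form u (v - v') = form u v - form u v'.
Proof. by rewrite vformDr -scaleN1r vformZr mulN1r. Qed.

Lemma vform_sumr (I : Type) (s : seq I) (c : I -> K) (u : I -> V) v :
  form v (\sum_(k <- s) c k *: u k) = \sum_(k <- s) c k * form v (u k).
Proof.
elim: s => [|k s IH]; first by rewrite !big_nil vform0r.
by rewrite !big_cons vformDr vformZr IH.
Qed.

Lemma vform_suml (I : Type) (s : seq I) (c : I -> K) (u : I -> V) v :
  form (\sum_(k <- s) c k *: u k) v = \sum_(k <- s) c k * form (u k) v.
Proof.
rewrite (form_sym h_form) vform_sumr; apply: eq_bigr => k _.
by rewrite (form_sym h_form).
Qed.

Lemma form_Fop u x v : form u (Fop x v) = form (Eop (rev x) u) v.
Proof.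
elim: x u => [|i x IH] u //; rewrite rev_cons /Eop foldr_rcons -/(Eop _ _) -IH.
by rewrite (form_adj h_form).
Qed.

Lemma phi_Eop u y x : phi (Eop (rev y) u) x = phi u (y ++ x).
Proof. by rewrite /phi -form_Fop -Fop_cat. Qed.

Lemma serre_phi u : serre_fun q (phi u).
Proof.
have [h1 h2] := serre_Fop v0; split=> p i j s ij; rewrite /phi /fvec.
  by rewrite h1.
have := congr1 (form u) (h2 p i j s ij).
by rewrite vformDr vformBr vformZr vform0r.
Qed.

Lemma form_v0F i v : form v0 (opF i v) = 0.
Proof.
rewrite -(form_adj h_form) (thetaV_E hV).
by rewrite (form_sym h_form) vform0r.
Qed.

(** Every $E_j$ kills the difference, because $i\mapsto\theta(i)$ exchanges the two delta terms and
    $T_jv_0=v_0$. The difference is thus a multiple of [v0], and it is orthogonal to [v0]. *)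
Lemma opF_theta i : opF i v0 = opF (thetaJ i) v0.
Proof.
have thetaK j : thetaJ (thetaJ j) = j.
  by apply: num_inj; rewrite !num_theta opprK.
apply: subr0_eq; set v := _ - _.
have [c ev] : exists c, v = c *: v0.
  apply/(thetaV_ker hV) => j; rewrite linearB /=.
  rewrite !opE_opF !(thetaV_E hV) !(thetaV_T hV) !linear0 ?scaler0 !add0r.
  have -> : (j == thetaJ i) = (thetaJ j == i).
    by apply/eqP/eqP => [->|<-]; rewrite thetaK.
  have -> : (thetaJ j == thetaJ i) = (j == i).
    by apply/eqP/eqP => [/(congr1 thetaJ)|->] //; rewrite !thetaK.
  by case: (j == i); case: (thetaJ j == i); rewrite /= ?scale1r ?scale0r ?addr0 ?add0r
    ?subrr ?oppr0.
have : form v0 v = 0 by rewrite vformBr !form_v0F subr0.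
by rewrite ev vformZr (form_v0 h_form) mulr1 => ->; rewrite scale0r.
Qed.

Lemma flip_phi u : flip_fun (phi u).
Proof. by move=> p j; rewrite /phi /fvec !Fop_cat /Fop /= opF_theta. Qed.

(** Both sides satisfy the same recursion, once the outer $F_i$ is moved to [u] as $E_i$. *)
Lemma form_sact_rootP a n u v z :
  form u (sact (Defs.rootP (rev (seg a n.+1))) (Fop z v)) =
  root_fun q a n (fun y => form u (Fop y v)) z.
Proof.
elim: n u z => [|n IH] u z; first by rewrite seg_cons seg0 sact_f.
rewrite seg_rcons rev_rcons sact_rootP; last by rewrite -size_eq0 size_rev size_seg.
rewrite vformBr vformZr -[opF _ (Fop z v)]/(Fop (shift a n.+1 :: z) v) IH.
rewrite -(form_adj h_form) IH.
congr (_ - _ * _); apply: root_fun_ext => y.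
by rewrite (form_adj h_form).
Qed.

(** The last factor of the product acts outermost. Only its leading word survives, by
    [root_fun_max], and adjunction moves that word to [u], where the induction hypothesis
    applies. *)
Lemma form_sact_prod (L : seq word) u :
  (forall w, w \in L -> exists s, w = rev (segw s)) ->
  zero_above (phi u) (rev (flatten L)) ->
  form u (sact (\prod_(w <- L) Defs.rootP w) v0) = phi u (rev (flatten L)).
Proof.
elim/last_ind: L u => [|L w IH] u hL za; first by rewrite big_nil sact1.
have [[a n] ew] : exists s, w = rev (segw s) by apply: hL; rewrite mem_rcons mem_head.
have {}IH u' : zero_above (phi u') (rev (flatten L)) ->
    form u' (sact (\prod_(w <- L) Defs.rootP w) v0) = phi u' (rev (flatten L)).
  by apply: IH => v vL; apply: hL; rewrite mem_rcons inE vL orbT.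
set x := rev (flatten L) in IH *; set v := sact _ _ in IH.
have ex : rev (flatten (rcons L w)) = seg a n.+1 ++ x.
  by rewrite flatten_rcons rev_cat ew revK.
rewrite ex in za *; rewrite -cats1 big_cat big_seq1.
apply: (etrans (congr1 _ (sactM _ _ _))); rewrite -/v ew.
have phiE y : zero_above (phi (Eop (rev y) u)) x ->
    form u (Fop y v) = phi u (y ++ x).
  by move=> zy; rewrite form_Fop IH // phi_Eop.
apply: etrans (form_sact_rootP a n u v [::]) _.
have zseg : zero_above (phi (Eop (rev (seg a n.+1)) u)) x.
  by move=> y sy xy; rewrite phi_Eop; apply: zero_above_cat za _ sy xy.
rewrite root_fun_max /= ?cats0 ?phiE // => y sy ly.
have big z : size z = size x -> phi u (y ++ z) = 0.
  move=> sz; apply: za; first by rewrite !size_cat sy sz size_seg.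
  by rewrite llt_catr // size_seg.
by rewrite cats0 phiE ?big // => z sz _; rewrite phi_Eop big.
Qed.

(** Only the leading word of the PBW vector survives, and the divided powers contribute the factor
    $\kappa^{-1}$. *)
Lemma form_thetaP u w : is_lyndon_fact w (lyndon_fact w) ->
  (forall p, p \in lyndon_fact w -> exists s, p.1 = rev (segw s)) ->
  zero_above (phi u) (rev w) ->
  form u (thetaP v0 w) = (kappa w)^-1 * phi u (rev w).
Proof.
move=> [_ _ ew] hseg za.
pose L := flatten [seq nseq p.2 p.1 | p <- lyndon_fact w].
have eL : flatten L = w.
  rewrite [RHS]ew /L; elim: (lyndon_fact w) => //= p f IH.
  by rewrite flatten_cat IH.
rewrite /thetaP divP_prod -/(kappa w).
apply: etrans (congr1 (form u) (sactZ _ _ _)) _; rewrite vformZr; congr (_ * _).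
rewrite -[in RHS]eL; apply: form_sact_prod; last by rewrite -/L eL.
move=> v /flattenP[_ /mapP[p pf ->] /nseqP[-> _]]; exact: hseg.
Qed.

End ThetaModule.

Lemma ekact_closed (V : ekModule) (W : set V) :
  W 0 -> (forall u v, W u -> W v -> W (u + v)) ->
  (forall c u, W u -> W (c *: u)) ->
  (forall i u, W u -> W (opE i u)) -> (forall i u, W u -> W (opF i u)) ->
  (forall i u, W u -> W (opT i u)) -> (forall i u, W u -> W (opTinv i u)) ->
  submodule W.
Proof.
move=> W0 WD WZ WE WF WT WTinv; split=> // a u Wu.
rewrite [a]quot_spanE ekact_sum; elim/big_ind: _ => // m _; apply: WZ.
rewrite qproj_monom; elim: (m : seq ekgen) => [|g w IH].
  by rewrite big_nil ekact1.
by rewrite big_cons ekactM; case: g => i; [apply: WE|apply: WF|apply: WT|apply: WTinv].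
Qed.

(** * Weight spaces, nondegeneracy and the coefficients of theta-Psi *)

Section Weights.
Variables (V : ekModule) (v0 : V).
Hypothesis hV : is_thetaV v0.
Implicit Types (u v : V) (i j : J) (x y : seq J) (w : word) (beta : rootQ).
Local Notation fvec := (fvec v0).
Local Notation Vhom := (Vhom v0).

Lemma fvec_cons i x : fvec (i :: x) = opF i (fvec x).
Proof. by []. Qed.

Lemma Vhom_fvec x : Vhom (twt x) (fvec x).
Proof.
exists [:: (1, x)]; rewrite big_seq1 scale1r f_act_fword; split=> // t.
by rewrite inE => /eqP->.
Qed.

Lemma VhomD beta u v : Vhom beta u -> Vhom beta v -> Vhom beta (u + v).
Proof.
move=> [s [hs ->]] [t [ht ->]]; exists (s ++ t); rewrite big_cat; split=> // r.
by rewrite mem_cat => /orP[/hs|/ht].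
Qed.

Lemma VhomZ beta c u : Vhom beta u -> Vhom beta (c *: u).
Proof.
move=> [s [hs ->]]; exists [seq (c * t.1, t.2) | t <- s]; split.
  by move=> r /mapP[t /hs ? ->].
by rewrite big_map scaler_sumr; apply: eq_bigr => t _; rewrite scalerA.
Qed.

Lemma Vhom0 beta : Vhom beta 0.
Proof. by exists [::]; rewrite big_nil. Qed.

Lemma Vhom_linear beta gamma (f : {linear V -> V}) u :
  (forall x, twt x = beta -> Vhom gamma (f (fvec x))) ->
  Vhom beta u -> Vhom gamma (f u).
Proof.
move=> hf [s [hs ->]]; rewrite linear_sum big_seq.
elim/big_ind: _ => [|a b|t ts]; [exact: Vhom0|exact: VhomD|].
by rewrite linearZ f_act_fword; apply/VhomZ/hf/hs.
Qed.

Lemma opF_Vhom i beta u : Vhom beta u -> Vhom (beta + twt [:: i]) (opF i u).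
Proof.
apply: Vhom_linear => x <-; rewrite addrC -twt_cons; exact: Vhom_fvec.
Qed.

Lemma opT_fvec i x : exists2 c, c != 0 & opT i (fvec x) = c *: fvec x.
Proof.
elim: x => [|j x [c c0 IH]].
  by exists 1; rewrite ?oner_eq0 // (thetaV_T hV) scale1r.
exists (q ^ (- dotQ (alpha i + alpha (thetaJ i)) (alpha j)) * c).
  exact: mulf_neq0 (expfz_neq0 _ q_neq0) c0.
rewrite fvec_cons opT_opF IH linearZ.
by rewrite scalerA.
Qed.

Lemma opE_fvec i x : Vhom (twt x - twt [:: i]) (opE i (fvec x)).
Proof.
elim: x => [|j x IH]; first by rewrite [opE _ _](thetaV_E hV); apply: Vhom0.
rewrite fvec_cons opE_opF; apply: VhomD; first apply: VhomD.
- by apply: VhomZ; rewrite twt_cons [twt [:: j] + _]addrC addrAC; apply: opF_Vhom.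
- have [<-|_] := eqVneq i j; last by rewrite scale0r; apply: Vhom0.
  by rewrite scale1r twt_cons addrAC subrr add0r; apply: Vhom_fvec.
- case: eqP => [<-|_]; last exact: Vhom0.
  rewrite twt_cons twt_theta addrAC subrr add0r.
  by have [c _ ->] := opT_fvec i x; apply/VhomZ/Vhom_fvec.
Qed.

Lemma opE_Vhom i beta u : Vhom beta u -> Vhom (beta - twt [:: i]) (opE i u).
Proof. by apply: Vhom_linear => x <-; apply: opE_fvec. Qed.

Lemma Eop_Vhom x beta u : Vhom beta u -> Vhom (beta - twt x) (Eop x u).
Proof.
elim: x => [|i x IH] hu; first by rewrite (_ : twt [::] = 0) ?subr0 //; apply/malgP => k;
  rewrite twt_coef mcoeff0.
by rewrite twt_cons opprD addrCA addrC; apply/opE_Vhom/IH.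
Qed.

Lemma Vhom_v0 u : Vhom (twt [::]) u -> exists c, u = c *: v0.
Proof.
move=> [s [hs ->]]; exists (\sum_(t <- s) t.1); rewrite scaler_suml big_seq [RHS]big_seq.
by apply: eq_bigr => t /hs /twt_eq0 ->; rewrite f_act_fword.
Qed.

(** The span of the vectors [fvec x] is stable under all generators and contains [v0], so
    irreducibility applies. *)
Lemma fvec_span u : exists s : seq (K * word), u = \sum_(t <- s) t.1 *: fvec t.2.
Proof.
pose W : set V := [set u | exists s : seq (K * word), u = \sum_(t <- s) t.1 *: fvec t.2].
have W0 : W 0 by exists [::]; rewrite big_nil.
have WD v v' : W v -> W v' -> W (v + v').
  by move=> [s ->] [t ->]; exists (s ++ t); rewrite big_cat.
have WZ c v : W v -> W (c *: v).
  move=> [s ->]; exists [seq (c * t.1, t.2) | t <- s].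
  by rewrite big_map scaler_sumr; apply: eq_bigr => t _; rewrite scalerA.
have Wv x : W (fvec x) by exists [:: (1, x)]; rewrite big_seq1 scale1r.
have Wlin (f : {linear V -> V}) v : (forall x, W (f (fvec x))) -> W v -> W (f v).
  move=> hf [s ->]; rewrite linear_sum; elim/big_ind: _ => // t _.
  by rewrite linearZ; apply/WZ/hf.
have WH beta v : Vhom beta v -> W v.
  by move=> [s [_ ->]]; exists s; apply: eq_bigr => t _; rewrite f_act_fword.
suff: W u by [].
apply: (thetaV_irr hV _ (Wv [::]) (thetaV_v0 hV)).
apply: ekact_closed => // i v; apply: Wlin => x /=.
- exact: WH (opE_fvec i x).
- exact: (Wv (i :: x)).
- by have [c _ ->] := opT_fvec i x; apply: WZ.
- have [c c0 e] := opT_fvec i x.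
  have -> : opTinv i (fvec x) = c^-1 *: fvec x.
    apply: (scalerI c0); rewrite scalerA divff // scale1r -linearZ -e.
    exact: opTK.
  exact: WZ.
Qed.

Variable form : V -> V -> K.
Hypothesis h_form : is_form v0 form.
Local Notation phi := (phi v0 form).

(** Moving the letters of [x] across the form lowers the weight of [u] step by step; at the end a
    vector of nonzero weight is paired with [v0], which is orthogonal to the image of every
    $F_i$. *)
Lemma phi_Vhom beta u x : Vhom beta u -> twt x <> beta -> phi u x = 0.
Proof.
elim: x beta u => [|i x IH] beta u hu ne.
  case: hu => s [hs ->]; rewrite [LHS](vform_suml h_form) big_seq big1 // => t ts.
  rewrite f_act_fword; case: (t.2) (hs _ ts) => [/ne//|j y _].
  by rewrite (form_sym h_form) (form_v0F hV h_form) mulr0.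
rewrite /phi fvec_cons -(form_adj h_form).
apply: IH (opE_Vhom i hu) _ => e; apply: ne.
by rewrite twt_cons e addrC subrK.
Qed.

(** The radical of the form is a submodule that does not contain [v0], so it is zero by
    irreducibility. *)
Lemma form_nondeg u : (forall x, phi u x = 0) -> u = 0.
Proof.
move=> h; have {}h v : form u v = 0.
  have [s ->] := fvec_span v; rewrite (vform_sumr h_form) big1 // => t _.
  by rewrite [form _ _]h mulr0.
pose W : set V := [set u | forall v, form u v = 0].
have fD v v' (w : V) : form (v + v') w = form v w + form v' w.
  by rewrite !(form_sym h_form _ w) (vformDr h_form).
have fZ c v (w : V) : form (c *: v) w = c * form v w.
  by rewrite !(form_sym h_form _ w) (vformZr h_form).
have adjF i v (w : V) : form (opF i v) w = form v (opE i w).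
  by rewrite (form_sym h_form) -(form_adj h_form) (form_sym h_form).
(* The boson relation expresses $T_i$ through $E_i$ and $F_{\theta(i)}$ and, as $T_{\theta(i)}=T_i$,
   also through $E_{\theta(i)}$ and $F_i$; these two expressions are adjoint to each other. *)
have Tsym i v (w : V) : form (opT i v) w = form v (opT i w).
  have TE z : opT i z = opE i (opF (thetaJ i) z)
      - q ^ (- dotJ i (thetaJ i)) *: opF (thetaJ i) (opE i z).
    rewrite opE_opF eqxx; have -> : (i == thetaJ i) = false.
      apply/negP => /eqP /(congr1 num); rewrite num_theta.
      by have [m ->] := num_odd i; lia.
    by rewrite scale0r addr0 addrC addKr.
  have TE' z : opT i z = opE (thetaJ i) (opF i z)
      - q ^ (- dotJ i (thetaJ i)) *: opF i (opE (thetaJ i) z).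
    rewrite opE_opF thetaJK eqxx opT_theta dotJC; have -> : (thetaJ i == i) = false.
      apply/negP => /eqP /(congr1 num); rewrite num_theta.
      by have [m ->] := num_odd i; lia.
    by rewrite scale0r addr0 addrC addKr.
  rewrite TE TE' (vformBr h_form) (vformZr h_form) fD -scaleN1r fZ fZ mulN1r.
  by rewrite (form_adj h_form i) adjF adjF (form_adj h_form i).
have WM : submodule W.
  apply: ekact_closed => //= [v|v v' hv hv' w|c v hv w|i v hv w|i v hv w|i v hv w|i v hv w].
  - by rewrite (form_sym h_form) (vform0r h_form).
  - by rewrite fD hv hv' addr0.
  - by rewrite fZ hv mulr0.
  - by rewrite (form_adj h_form) hv.
  - by rewrite adjF hv.
  - by rewrite Tsym hv.
  - by rewrite -(opTVK i w) -Tsym opTVK hv.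
have [//|u0] := eqVneq u 0.
have := thetaV_irr hV WM h u0 v0 v0; rewrite (form_v0 h_form) => /eqP.
by rewrite oner_eq0.
Qed.

(** Here [Eop w u] has weight zero, hence is a multiple of [v0], and pairing with [v0] reads off the
    multiple. *)
Lemma thetad_phi w u : Vhom (twt w) u -> thetad v0 w u = phi u (rev w).
Proof.
move=> hu; have [c ec] : exists c, Eop w u = c *: v0.
  apply: Vhom_v0; have := Eop_Vhom w hu; rewrite subrr.
  by rewrite (_ : twt [::] = 0) //; apply/malgP => k; rewrite twt_coef mcoeff0.
have e : Eop w u = thetad v0 w u *: v0.
  by apply: (@xgetPex _ _ [set c | foldr (@opE V) u w = c *: v0]); exists c.
rewrite /phi /fvec (form_Fop h_form) revK e (form_sym h_form) (vformZr h_form).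
by rewrite (form_v0 h_form) mulr1.
Qed.

Lemma thetaPsi_hom_coef beta u w : Vhom beta u ->
  (thetaPsi_hom v0 beta u)@_w = phi u (rev w).
Proof.
move=> hu; rewrite /thetaPsi_hom fsbig_finite; last exact: twt_finite.
rewrite raddf_sum /=.
have wE (v : word) : (thetad v0 v u *: wordV v)@_w = thetad v0 v u * (v == w)%:R.
  by rewrite mcoeffZ mcoeffU.
rewrite (eq_bigr _ (fun x _ => wE x)).
have [e|ne] := pselect (twt w = beta); last first.
  rewrite (phi_Vhom hu) ?twt_rev // big_seq big1 // => v.
  rewrite in_fset_set ?inE; last exact: twt_finite.
  by move=> /= ev; case: eqP => [E|_]; [case: ne; rewrite -E|rewrite mulr0].
have wB : w \in fset_set [set x | twt x = beta].
  by rewrite in_fset_set ?inE //; exact: twt_finite.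
rewrite (bigD1_seq w) ?fset_uniq //= eqxx mulr1 big1 ?addr0 => [|v /negPf->].
  by apply: thetad_phi; rewrite e.
by rewrite mulr0.
Qed.

Lemma weight_decomp_ex u : exists d, weight_decomp v0 u d.
Proof.
have [s ->] := fvec_span u.
pose d beta := \sum_(t <- s | twt t.2 == beta) t.1 *: fvec t.2.
pose B := undup [seq twt t.2 | t <- s].
have dB beta : beta \notin B -> d beta = 0.
  rewrite mem_undup => nB; rewrite /d big_seq_cond big1 // => t /andP[ts /eqP e].
  by case/negP: nB; apply/mapP; exists t.
exists d; split.
- move=> beta; rewrite /d; elim/big_ind: _ => [|a b|t /eqP<-].
  + exact: Vhom0.
  + exact: VhomD.
  + exact/VhomZ/Vhom_fvec.
- apply: (@sub_finite_set _ _ [set` B]); last exact: finite_seq.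
  by move=> beta /= nz; apply: contraNT nz => /dB ->.
- rewrite (fsbigE B) ?undup_uniq //= => [|beta _ /dB//].
  rewrite /d (exchange_big_dep xpredT) //= big_seq [RHS]big_seq.
  apply: eq_bigr => t ts.
  rewrite -big_filter (eq_filter (a2 := pred1 (twt t.2))) => [|beta /=]; last first.
    by rewrite in_setT eq_sym.
  rewrite filter_pred1_uniq ?big_seq1 ?undup_uniq // mem_undup.
  by apply/mapP; exists t.
Qed.

(** Whichever weight decomposition is chosen, the pairings of its components with [fvec (rev w)] add
    up to that of [u]. *)
Lemma thetaPsi_coef u w : (thetaPsi v0 u)@_w = phi u (rev w).
Proof.
rewrite /thetaPsi; set d := xget _ _.
have [hom fin ->] : weight_decomp v0 u d by apply: xgetPex; apply: weight_decomp_ex.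
have d0 beta : beta \notin fset_set [set beta | d beta != 0] -> d beta = 0.
  by rewrite in_fset_set // => /negP; rewrite in_setE /= => /negP; rewrite negbK => /eqP.
have Psi0 beta : d beta = 0 -> thetaPsi_hom v0 beta (d beta) = 0.
  move=> e; apply/malgP => v; rewrite mcoeff0 (thetaPsi_hom_coef _ (hom beta)) e.
  by rewrite /phi (form_sym h_form) (vform0r h_form).
rewrite (fsbigTE (fset_set [set beta | d beta != 0])); last first.
  by move=> beta /d0; apply: Psi0.
rewrite (fsbigTE (fset_set [set beta | d beta != 0])) //.
rewrite raddf_sum /phi (form_sym h_form); set A := fset_set _.
transitivity (\sum_(beta <- A) 1 * form (fvec (rev w)) (d beta)).
  apply: eq_bigr => beta _; rewrite mul1r (form_sym h_form).
  exact: thetaPsi_hom_coef (hom beta).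
by rewrite -(vform_sumr h_form); congr form; apply: eq_bigr => beta _; rewrite scale1r.
Qed.

End Weights.

(* Largest words of a given weight *)
Local Opaque thetaPsi.

Lemma wlt_wleF u v : wlt u v -> wle v u -> False.
Proof.
rewrite wltE wleE => uv /orP[/eqP e|vu]; first by rewrite e llt_irr in uv.
by have := llt_trans uv vu; rewrite llt_irr.
Qed.

Lemma max_of_weight (P : word -> Prop) w : P w ->
  exists m, [/\ P m, twt m = twt w & forall x, P x -> twt x = twt w -> wle x m].
Proof.
move=> Pw; pose A := [set x | P x /\ twt x = twt w].
have /finite_seqP[s es] : finite_set A.
  by apply: sub_finite_set (twt_finite (twt w)) => x [].
have mem_s x : x \in s <-> A x by rewrite es.
have maxs (t : seq word) : t != [::] -> exists2 m, m \in t & forall x, x \in t -> wle x m.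
  elim: t => // x t IH _; have [->|nt] := eqVneq t [::].
    exists x; rewrite ?mem_head // => y; rewrite inE => /eqP->; exact: wle_refl.
  have [m mt hm] := IH nt; have [xm|mx] := orP (wle_total x m).
    exists m; rewrite ?inE ?mt ?orbT // => y; rewrite inE => /orP[/eqP->//|]; exact: hm.
  exists x; rewrite ?mem_head // => y; rewrite inE => /orP[/eqP->|/hm ym].
    exact: wle_refl.
  by apply: wle_trans ym _; move: mx; rewrite wltE wleE => ->; rewrite orbT.
have [|m /mem_s[Pm em] hm] := maxs s.
  by apply/eqP => s0; have /mem_s : A w by []; rewrite s0.
by exists m; split=> // x Px ex; apply/hm/mem_s.
Qed.

(** Comparison of one end of the two words gives -a = a + 2n. *)
Lemma lsym_segw s : lsym (rev (segw s)) -> seg_sym s.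
Proof.
case: s => a n; rewrite /lsym /thetaw map_rev revK => /eqP /(congr1 (head a)).
rewrite /segw seg_cons -seg_cons seg_rcons rev_rcons -seg_rcons seg_cons /=.
by move/(congr1 num); rewrite num_theta num_shift => e; apply/seg_symP => /=; lia.
Qed.

(** * Dual bases *)

Section Duality.
Variables (V : ekModule) (v0 : V) (form : V -> V -> K).
Hypotheses (hV : is_thetaV v0) (h_form : is_form v0 form).
Implicit Types (u v : V) (i j : J) (x y : seq J) (w : word) (beta : rootQ).
Local Notation phi := (phi v0 form).
Local Notation Psi := (thetaPsi v0).

Let coef u w : (Psi u)@_w = phi u (rev w) := thetaPsi_coef hV h_form u w.

Lemma phiD u v x : phi (u + v) x = phi u x + phi v x.
Proof. by rewrite /phi !(form_sym h_form _ (fvec _ _)) (vformDr h_form). Qed.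

Lemma phiZ c u x : phi (c *: u) x = c * phi u x.
Proof. by rewrite /phi !(form_sym h_form _ (fvec _ _)) (vformZr h_form). Qed.

Lemma thetaPsi_is_linear : linear (Psi : V -> wordSpan).
Proof.
move=> c u v; apply/malgP => w; rewrite coef phiD phiZ.
apply/esym; apply: etrans (mcoeffD _ _ _) _; rewrite (coef v); congr (_ + _).
by apply: etrans (mcoeffZ _ _ _) _; rewrite (coef u).
Qed.

HB.instance Definition _ := GRing.isLinear.Build K V wordSpan *:%R Psi thetaPsi_is_linear.

Lemma thetaPsiD u v : Psi (u + v) = Psi u + Psi v.
Proof. exact: linearD. Qed.

Lemma thetaPsi_sum (s : seq word) (c : word -> K) (u : word -> V) :
  Psi (\sum_(x <- s) c x *: u x) = \sum_(x <- s) c x *: Psi (u x).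
Proof. by rewrite linear_sum; apply: eq_bigr => x _; rewrite linearZ. Qed.

Lemma thetaPsi_inj : injective Psi.
Proof.
move=> u v e; apply: subr0_eq; apply: (form_nondeg hV h_form) => x.
rewrite -scaleN1r phiD phiZ mulN1r; apply/eqP; rewrite subr_eq0.
by rewrite -[x]revK -!coef e.
Qed.

Lemma thetaPsiK u : thetaPsi_inv v0 (Psi u) = u.
Proof.
by apply: thetaPsi_inj; apply: (@xgetPex _ _ [set v | Psi v = Psi u]); exists u.
Qed.

Lemma bform_thetaPsi u v : bform v0 form (Psi u) (Psi v) = form u v.
Proof. exact: congr2 (thetaPsiK u) (thetaPsiK v). Qed.

(** Different weights are orthogonal, so the component of weight [beta] keeps all pairings in that
    weight. This reduces statements about dual basis vectors to homogeneous ones. *)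
Lemma weight_component u beta : exists u', [/\ Vhom v0 beta u',
  forall x, twt x = beta -> phi u' x = phi u x
  & forall v, Vhom v0 beta v -> form u' v = form u v].
Proof.
have [s ->] := fvec_span hV u.
pose u' := \sum_(t <- s | twt t.2 == beta) t.1 *: fvec v0 t.2.
have hphi x : twt x = beta -> phi u' x = phi (\sum_(t <- s) t.1 *: fvec v0 t.2) x.
  move=> ex; rewrite /u' -big_filter /phi !(vform_suml h_form) big_filter big_mkcond.
  apply: eq_bigr => t _; case: eqP => // ne.
  by rewrite [form _ _](phi_Vhom hV h_form (Vhom_fvec v0 t.2)) ?mulr0 // ex => /esym.
exists u'; split=> //.
  rewrite /u'; elim/big_ind: _ => [|a b|t /eqP<-].
  - exact: Vhom0.
  - exact: VhomD.
  - exact/VhomZ/Vhom_fvec.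
move=> v [r [hr ->]]; rewrite !(vform_sumr h_form) big_seq [RHS]big_seq.
by apply: eq_bigr => t tr; rewrite f_act_fword [form u' _]hphi //; apply: hr.
Qed.

Lemma zero_above_max u w : Vhom v0 (twt w) u ->
  (forall x, phi u x != 0 -> wle (rev x) w) -> zero_above (phi u) (rev w).
Proof.
move=> hu hm y _ wy; apply/eqP/negPn/negP => nz.
by apply: (wlt_wleF _ (hm _ nz)); rewrite wltE revK.
Qed.

Lemma theta_goodP w : theta_good v0 w -> exists u, [/\ Vhom v0 (twt w) u,
  phi u (rev w) != 0 & zero_above (phi u) (rev w)].
Proof.
move=> [beta [u [hu _ [nz mx]]]]; rewrite coef in nz.
have eb : twt w = beta.
  rewrite -twt_rev; apply: contra_notP (elimN eqP nz) => ne.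
  exact: phi_Vhom hu ne.
subst beta; exists u; split; [exact hu|exact nz|].
apply: zero_above_max hu _ => x nx; by apply: mx; rewrite (coef u) revK.
Qed.

Lemma theta_good_max u w : phi u (rev w) != 0 ->
  (forall x, phi u (rev x) != 0 -> twt x = twt w -> wle x w) -> theta_good v0 w.
Proof.
move=> nz mx; have [u' [hu' e _]] := weight_component u (twt w).
have nz' : phi u' (rev w) != 0 by rewrite e ?twt_rev.
exists (twt w), u'; split; [exact hu'| |].
  apply: contraNneq nz' => ->; by rewrite -(scale0r 0) phiZ mul0r.
split=> [|x]; rewrite coef; first exact: nz'; move=> nx.
have ex : twt x = twt w.
  rewrite -twt_rev; apply: contra_notP (elimN eqP nx) => ne.
  exact: phi_Vhom hu' ne.
apply: (mx x _ ex); rewrite -(e (rev x)) ?twt_rev; [exact nx|exact ex].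
Qed.

Lemma theta_good_segs w : theta_good v0 w -> exists S,
  [/\ rev w = segsw S, sorted seg_ge S & all seg_pos S].
Proof.
move=> /theta_goodP[u [hu nz za]]; have sp := serre_phi h_form u.
have [S [eS sS]] := segs_of_max q_addV_neq0 sp nz za.
exists S; split; [exact eS|exact sS|]; rewrite eS in nz za.
apply: (segs_pos_of_max q_neq0 q_addV_neq0 sp (flip_phi hV h_form u) sS nz za).
move=> y nzy k; rewrite -eS cnt_rev; move: k; apply/twtP.
apply: contra_notP (elimN eqP nzy) => ne; exact: phi_Vhom hu ne.
Qed.

Lemma theta_good_fact w : theta_good v0 w -> is_lyndon_fact w (lyndon_fact w).
Proof.
move=> /theta_good_segs[S [eS sS _]]; rewrite -[w]revK eS.
exact: lyndon_fact_segsw.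
Qed.

(** With the letters around the factor fixed, the functional of [w] becomes one whose largest word
    is the factor. Hence the factor is a product of segments, and a single one because it is
    Lyndon. *)
Lemma theta_good_factor w p : theta_good v0 w -> p \in lyndon_fact w ->
  exists s, p.1 = rev (segw s).
Proof.
move=> gw pf; have [hl _ ew] := theta_good_fact gw.
have [lp p0] := hl _ pf.
have [A [B eAB]] : exists A B, w = A ++ p.1 ++ B.
  rewrite [w]ew; elim: (lyndon_fact w) pf => // r f IH.
  rewrite inE => /orP[/eqP<-|/IH[A [B e]]].
    exists [::], (flatten (nseq p.2.-1 p.1) ++ flatten [seq flatten (nseq r.2 r.1) | r <- f]).
    by rewrite /= -{1}(prednK p0) /= -catA.
  by exists (flatten (nseq r.2 r.1) ++ A), B; rewrite /= e -catA.
have [u [hu nz za]] := theta_goodP gw.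
rewrite eAB !rev_cat -!catA in nz za.
have sp := serre_fun_catr (rev A) (serre_fun_cat (rev B) (serre_phi h_form u)).
have [|S [eS sS]] := segs_of_max q_addV_neq0 sp nz.
  move=> y sy ly; apply: za; first by rewrite !size_cat sy.
  by rewrite llt_cat2l llt_catr.
have [s es] : exists s, S = [:: s] by apply: lyndon_segsw sS _; rewrite -eS revK.
by exists s; rewrite -[p.1]revK eS es segswS cats0.
Qed.

Lemma sact_rootP_Vhom w beta v : Vhom v0 beta v ->
  Vhom v0 (beta + twt w) (sact (Defs.rootP w) v).
Proof.
have t0 : twt [::] = 0 by apply/malgP => k; rewrite twt_coef mcoeff0.
elim: w beta v => [|i w IH] beta v hv; first by rewrite t0 addr0 sact1.
have [->|nw] := eqVneq w [::]; first by rewrite sact_f; apply: opF_Vhom.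
rewrite sact_rootP // -scaleN1r; apply: VhomD.
  by rewrite twt_cons addrA; apply/IH/opF_Vhom.
apply/VhomZ/VhomZ; rewrite twt_cons [twt _ + _]addrC addrA.
exact/opF_Vhom/IH.
Qed.

Lemma thetaP_Vhom w : is_lyndon_fact w (lyndon_fact w) ->
  Vhom v0 (twt w) (thetaP v0 w).
Proof.
move=> [_ _ ew]; rewrite /thetaP divP_prod.
have -> : f_act (sigma ((kappa w)^-1 *: \prod_(v <- flatten [seq nseq p.2 p.1
      | p <- lyndon_fact w]) Defs.rootP v)) v0 = (kappa w)^-1 *:
    sact (\prod_(v <- flatten [seq nseq p.2 p.1 | p <- lyndon_fact w]) Defs.rootP v) v0.
  exact: sactZ.
apply: VhomZ; set L := flatten _.
have <- : flatten L = w.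
  rewrite [RHS]ew /L; elim: (lyndon_fact w) => //= p f IH.
  by rewrite flatten_cat IH.
elim/last_ind: L => [|L v IH]; first by rewrite big_nil sact1; apply: Vhom_fvec [::].
rewrite -cats1 big_cat big_seq1 flatten_cat twt_cat /= cats0.
have -> : sact (\prod_(i <- L) Defs.rootP i * Defs.rootP v) v0 =
    sact (Defs.rootP v) (sact (\prod_(i <- L) Defs.rootP i) v0) by apply: sactM.
exact: sact_rootP_Vhom.
Qed.

Lemma above_finite mu : finite_set (above v0 mu).
Proof. by apply: sub_finite_set (twt_finite (twt mu)) => x []. Qed.

(* For the largest word of a given weight at which the pairing with the PBW vector
   is nonzero, the triangular expansion has a single nonzero term. *)
Lemma triangular_dual (bb : word -> V) (B : V) nu :
  (forall mu, theta_good v0 mu -> exists c : word -> K, bb mu = thetaP v0 mu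
     + \sum_(x \in above v0 mu) c x *: thetaP v0 x) ->
  (forall mu, theta_good v0 mu -> form B (bb mu) = (nu == mu)%:R) ->
  theta_good v0 nu ->
  (forall mu, theta_good v0 mu -> form B (thetaP v0 mu) != 0 ->
     twt mu = twt nu /\ wle mu nu) /\ form B (thetaP v0 nu) = 1.
Proof.
move=> bbE dual g_nu.
have pair mu : theta_good v0 mu ->
    (forall x, above v0 mu x -> form B (thetaP v0 x) = 0) ->
    form B (thetaP v0 mu) = (nu == mu)%:R.
  move=> g_mu ab; have [c ec] := bbE _ g_mu; have fin := above_finite mu.
  rewrite -dual // ec (vformDr h_form) fsbig_finite //.
  rewrite (vform_sumr h_form) big_seq big1 ?addr0 // => x.
  by rewrite in_fset_set // in_setE => /ab ->; rewrite mulr0.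
have small mu : theta_good v0 mu -> form B (thetaP v0 mu) != 0 ->
    twt mu = twt nu /\ wle mu nu.
  move=> g_mu nz.
  have [m [[g_m nz_m] em hm]] := @max_of_weight
    (fun x => theta_good v0 x /\ form B (thetaP v0 x) != 0) mu (conj g_mu nz).
  have e_m : nu = m.
    apply/eqP; move: nz_m; rewrite pair //; first by case: (nu == m) => //;
      rewrite mulr0n eqxx.
    move=> x [g_x ex lx]; apply/eqP/negPn/negP => nz_x.
    by apply: (wlt_wleF lx); apply: hm; rewrite ?ex.
  by rewrite e_m em; split=> //; apply: hm.
split; first exact: small.
rewrite pair ?eqxx // => x [g_x ex lx]; apply/eqP/negPn/negP => nz_x.
by have [_ /(wlt_wleF lx)] := small _ g_x nz_x.
Qed.

(** The largest word of a given weight on which [B] does not vanish is theta-good, and its PBW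
    pairing is its coefficient divided by kappa. The pairing is thus nonzero, so the word is at most
    [nu]. At [nu] itself the pairing is 1, which gives the coefficient. *)
Lemma max_of_dual (B : V) nu : theta_good v0 nu ->
  (forall mu, theta_good v0 mu -> form B (thetaP v0 mu) != 0 ->
     twt mu = twt nu /\ wle mu nu) -> form B (thetaP v0 nu) = 1 ->
  (forall w, phi B (rev w) != 0 -> wle w nu) /\ phi B (rev nu) = kappa nu.
Proof.
move=> g_nu small B_nu.
have lead w : theta_good v0 w ->
    (forall x, phi B (rev x) != 0 -> twt x = twt w -> wle x w) ->
    form B (thetaP v0 w) = (kappa w)^-1 * phi B (rev w).
  move=> g_w mx; have fw := theta_good_fact g_w.
  have [B' [hB' eB' fB']] := weight_component B (twt w).
  rewrite -fB'; last exact: thetaP_Vhom.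
  rewrite -(eB' (rev w)) ?twt_rev //; apply: form_thetaP => //.
    by move=> p; apply: theta_good_factor.
  apply: (zero_above_max hB') => x nx.
  have ex : twt x = twt w.
    by apply: contra_notP (elimN eqP nx) => ne; apply: phi_Vhom hB' ne.
  by apply: mx; [rewrite revK -(eB' x ex)|rewrite twt_rev].
have bound w : phi B (rev w) != 0 -> wle w nu.
  move=> nz; have [m [nz_m em hm]] :=
    @max_of_weight (fun x => phi B (rev x) != 0) w nz.
  have hm' x : phi B (rev x) != 0 -> twt x = twt m -> wle x m.
    by move=> nx ex; apply: hm; rewrite ?ex.
  have g_m := theta_good_max nz_m hm'.
  apply: wle_trans (hm _ nz erefl) _; apply: (small _ g_m _).2.
  rewrite (lead _ g_m hm'); exact: mulf_neq0 (invr_neq0 (kappa_neq0 _)) nz_m.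
split; first exact: bound.
have := lead _ g_nu (fun x nx _ => bound x nx).
by rewrite B_nu => e; apply: (mulfI (invr_neq0 (kappa_neq0 nu)));
  rewrite -e (mulVf (kappa_neq0 nu)).
Qed.

(** Both words are sorted products of positive segments, to which the two minimality lemmas apply.
    In the symmetric case the segments of [nu] are built from its Lyndon factors, in order to
    inherit their symmetry. *)
Lemma below_empty nu mu : theta_good v0 nu -> lyndon nu \/ wsym nu ->
  below v0 nu mu -> False.
Proof.
move=> g_nu h [g_mu e]; rewrite wltE.
have [S' [eS' sS' posS']] := theta_good_segs g_mu.
have cntE S : rev nu = segsw S -> forall k, cnt k (segsw S) = cnt k (segsw S').
  by move=> eS k; rewrite -eS -eS' !cnt_rev; move/twtP: e => ->.
case: h => [lyn|sym].
  have [S [eS sS posS]] := theta_good_segs g_nu.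
  have [s es] : exists s, S = [:: s] by apply: lyndon_segsw sS _; rewrite -eS revK.
  rewrite eS' eS es single_minimal //.
    by move: posS; rewrite es /= andbT.
  by rewrite -es; apply: cntE.
have [_ sf ew] := theta_good_fact g_nu.
have [|S [eS sS hS]] := segs_of_factors _ sf.
  by move=> p; apply: theta_good_factor.
rewrite -ew in eS; rewrite eS' eS symmetric_minimal //; last exact: cntE.
apply/allP => s /hS[p pf ep]; apply: lsym_segw; rewrite -ep.
exact: (allP sym).
Qed.

End Duality.

(** * Expansion of the dual canonical basis *)

Theorem corollary3p30
    (estar : J -> fAlg -> fAlg) (h_estar : is_estar estar)
    (V : ekModule) (v0 : V) (hV : is_thetaV v0)
    (form : V -> V -> K) (h_form : is_form v0 form)
    (bar : V -> V) (h_bar : is_bar v0 bar)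
    (b : word -> wordSpan) (h_b : is_canonical_basis v0 bar b)
    (bstar : word -> wordSpan) (h_bstar : is_dual_basis v0 form b bstar)
    (Pstar : word -> wordSpan) (h_Pstar : is_dual_basis v0 form (bP v0) Pstar)
    (nu : word) (h_nu : theta_good v0 nu) :
  [/\ bstar nu = Pstar nu
        + \sum_(mu \in below v0 nu)
            bform v0 form (bstar nu) (bP v0 mu) *: Pstar mu,
      is_max (bstar nu) nu,
      (bstar nu)@_nu = kappa nu
    & theta_lyndon estar nu \/ wsym nu -> bstar nu = Pstar nu].
Proof.
have bformE := bform_thetaPsi hV h_form.
have [[bs_up _] bs_dual] := h_bstar; have [[Ps_up Ps_span] Ps_dual] := h_Pstar.
have [[b_low _] b_tri] := h_b.
(* The computation takes place in [V]: [B] lifts [bstar nu], and [bb] below lifts the canonical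
   basis. *)
have [B _ eB] := bs_up _ h_nu.
pose a mu := form B (thetaP v0 mu).
pose bb mu := thetaPsi_inv v0 (b mu).
have bbK mu : theta_good v0 mu -> thetaPsi v0 (bb mu) = b mu.
  by move=> /b_low[u _ e]; rewrite /bb -e (thetaPsiK hV h_form).
have bbE mu : theta_good v0 mu -> exists c : word -> K, bb mu = thetaP v0 mu
     + \sum_(x \in above v0 mu) c x *: thetaP v0 x.
  move=> g_mu; have [[c [_ ec]] _] := b_tri _ g_mu; exists c.
  apply: (thetaPsi_inj hV h_form); rewrite (bbK _ g_mu) ec.
  rewrite (thetaPsiD hV h_form) !fsbig_finite; try exact: above_finite.
  by rewrite (thetaPsi_sum hV h_form).
have [small a_nu] : (forall mu, theta_good v0 mu -> a mu != 0 ->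
     twt mu = twt nu /\ wle mu nu) /\ a nu = 1.
  apply: (triangular_dual h_form bbE _ h_nu) => mu g_mu.
  by rewrite -bs_dual // -eB -(bbK _ g_mu) bformE.
have [mx k_nu] := max_of_dual hV h_form h_nu small a_nu.
have [c [[[c_good _] ec] _]] := Ps_span _ (bs_up _ h_nu).
(* Pairing the expansion in the dual PBW basis with the PBW vector of [mu] isolates the coefficient
   at [mu]. *)
have c_a mu : theta_good v0 mu -> c@_mu = a mu.
  move=> g_mu; pose Q w := thetaPsi_inv v0 (Pstar w).
  have QK w : theta_good v0 w -> thetaPsi v0 (Q w) = Pstar w.
    by move=> /Ps_up[u _ e]; rewrite /Q -e (thetaPsiK hV h_form).
  have eQ : B = \sum_(w <- msupp c) c@_w *: Q w.
    apply: (thetaPsi_inj hV h_form); rewrite eB ec (thetaPsi_sum hV h_form).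
    by apply: eq_big_seq => w /c_good g_w; congr (_ *: _); apply/esym/QK.
  have step w : w \in msupp c -> c@_w * form (Q w) (thetaP v0 mu) = c@_w * (w == mu)%:R.
    by move=> /c_good g_w; rewrite -bformE QK // Ps_dual.
  rewrite /a eQ (vform_suml h_form) big_seq (eq_bigr _ step) -big_seq.
  have [mu_c|mu_c] := boolP (mu \in msupp c).
    rewrite (bigD1_seq mu) ?fset_uniq //= eqxx mulr1 big1 ?addr0 // => w /negPf->.
    by rewrite mulr0.
  rewrite mcoeff_outdom // big_seq big1 // => w w_c.
  by case: eqP => [e|_]; [rewrite -e w_c in mu_c|rewrite mulr0].
have below_finite : finite_set (below v0 nu).
  by apply: sub_finite_set (twt_finite (twt nu)) => x [].
have expansion : bstar nu = Pstar nu
    + \sum_(mu \in below v0 nu) bform v0 form (bstar nu) (bP v0 mu) *: Pstar mu.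
  have nu_c : nu \in msupp c by rewrite -mcoeff_neq0 c_a // a_nu oner_neq0.
  apply: (etrans ec); apply: (etrans (bigD1_seq _ nu_c (fset_uniq _))).
  apply: (congr2 (fun x y : wordSpan => x + y)).
    by rewrite (c_a _ h_nu) a_nu scale1r.
  pose r := [seq w <- msupp c | w != nu].
  have rP w : w \in r -> below v0 nu w.
    rewrite mem_filter => /andP[ne w_c]; have g_w := c_good _ w_c.
    have [|ew lw] := small w g_w; first by rewrite -(c_a _ g_w) mcoeff_neq0.
    by split=> //; rewrite /wlt ne.
  have uniq_r : uniq r by rewrite filter_uniq ?fset_uniq.
  (* Words below [nu] outside the support of [c] have coefficient zero, so the sum reduces to the
     support without [nu]. *)
  apply/esym; apply: (etrans (fsbigE r _ uniq_r _ _)) => [w /rP//|w [g_w _ lw] w_r|].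
    have -> : bform v0 form (bstar nu) (bP v0 w) = c@_w.
      by rewrite -eB bformE (c_a _ g_w).
    rewrite mcoeff_outdom ?scale0r //; apply: contra w_r => w_c.
    by rewrite mem_filter w_c andbT; case/andP: lw.
  rewrite -[RHS]big_filter -/r big_mkcond; apply: eq_big_seq => w w_r.
  rewrite ifT; last by rewrite in_setE; apply: rP.
  have w_c : w \in msupp c by move: w_r; rewrite mem_filter => /andP[].
  by apply: (congr1 (fun x => x *: Pstar w)); rewrite -eB bformE (c_a _ (c_good _ w_c)).
split.
- exact: expansion.
- split=> [|w]; rewrite -eB (thetaPsi_coef hV h_form); first by rewrite k_nu kappa_neq0.
  exact: mx.
- by rewrite -eB (thetaPsi_coef hV h_form).
move=> h; rewrite expansion fsbig1 ?addr0 // => mu hmu.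
have h' : lyndon nu \/ wsym nu by case: h => [[_ l _]|s]; [left|right].
by case: (below_empty hV h_form h_nu h' hmu).
Qed.
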